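(* Let $a\in\{1,2,4,8\}$. The variety of reductions $Y_a$ is a compactification of the affine space $\mathbf C^{3a}$, i.e. it contains a dense Zariski open subset isomorphic to $\mathbf C^{3a}$.
   Context: For $a=1,2,4,8$, $\mathbb A$ is the complexification of $\mathbf R,\mathbf C,\mathbf H,\mathbf O$ respectively: a complex composition algebra of dimension $a$ with conjugation $x\mapsto\bar x$ and quadratic form $q$, $x\bar x=q(x)1$. $\mathcal J_3(\mathbb A)$ is the complex vector space (dimension $3a+3$) of $3\times3$ $\mathbb A$-Hermitian matrices (diagonal entries in $\mathbf C$, off-diagonal entries in $\mathbb A$). $\mathcal J_3(\mathbb A)_0$ is the subspace of traceless matrices (dimension $3a+2$). The Severi variety is $X_a=\{[X]: X^2=\operatorname{trace}(X)X\}\subset\mathbb P\mathcal J_3(\mathbb A)$, smooth of dimension $2a$. $I$ is the identity matrix. $G(2,V)$ is the Grassmannian of $2$-dimensional subspaces of $V$ (lines in $\mathbb P(V)$). A plane in $\mathbb P\mathcal J_3(\mathbb A)$ is simply $3$-secant to $X_a$ if it meets $X_a$ in exactly three points, each a simple contact. Projection from $[I]$, $X\mapsto X-\frac13\operatorname{trace}(X)I$, sends each plane through $[I]$ to a line in $\mathbb P\mathcal J_3(\mathbb A)_0$. The variety of reductions $Y_a\subset G(2,\mathcal J_3(\mathbb A)_0)$ is the Zariski closure of the set of lines that are images of planes through $[I]$ which are simply $3$-secant to $X_a$. *)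

(* Defs.v *)
From HB Require Import structures.
From mathcomp Require Import all_boot all_order all_algebra.
From mathcomp Require Import reals complex mpoly.

Set Implicit Arguments.
Unset Strict Implicit.
Unset Printing Implicit Defensive.

Import GRing.Theory.
Local Open Scope ring_scope.

(** * Zariski geometry *)

(* A space with a notion of "form of degree [d]".  Closed sets are the common
   zero loci of forms, regular functions are locally quotients of two forms of
   the same degree.  For points of a projective variety a form takes its values
   on a fixed choice of homogeneous coordinates of each point; neither zero
   loci nor quotients of forms of equal degree depend on that choice. *)
Record formSpace (F : fieldType) := FormSpace {
  points :> Type;
  is_form : nat -> (points -> F) -> Prop }.

Section Zariski.
Variable F : fieldType.

Definition zclosed (T : formSpace F) (Z : T -> Prop) :=
  exists2 S : nat -> (T -> F) -> Prop,
    (forall d f, S d f -> is_form d f) &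
    (forall x, Z x <-> forall d f, S d f -> f x = 0).

Definition zopen (T : formSpace F) (O : T -> Prop) :=
  zclosed (fun x => ~ O x).

Definition zclosure (T : formSpace F) (A : T -> Prop) (x : T) :=
  forall Z : T -> Prop, zclosed Z -> (forall y, A y -> Z y) -> Z x.

(* Only the values of [f] on [X] matter; [X] carries the induced topology. *)
Definition regular_on (T : formSpace F) (X : T -> Prop) (f : T -> F) :=
  forall x, X x ->
  exists O : T -> Prop, [/\ zopen O, O x &
    exists d g h, [/\ is_form d g, is_form d h &
      forall y, X y -> O y -> h y != 0 /\ f y = g y / h y]].

(* Morphism from [X1] to [X2]: continuous, and pulls regular functions on open
   subsets of [X2] back to regular functions. *)
Definition zmorphism (T1 T2 : formSpace F) (X1 : T1 -> Prop) (X2 : T2 -> Prop)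
    (phi : T1 -> T2) :=
  [/\ forall x, X1 x -> X2 (phi x),
      forall O2 : T2 -> Prop, zopen O2 ->
        exists2 O1 : T1 -> Prop, zopen O1 &
          forall x, X1 x -> (O1 x <-> O2 (phi x)) &
      forall (O : T2 -> Prop) (f : T2 -> F), zopen O ->
        regular_on (fun y => X2 y /\ O y) f ->
        regular_on (fun x => X1 x /\ O (phi x)) (fun x => f (phi x))].

Definition zisomorphic (T1 T2 : formSpace F)
    (X1 : T1 -> Prop) (X2 : T2 -> Prop) :=
  exists (phi : T1 -> T2) (psi : T2 -> T1),
    [/\ zmorphism X1 X2 phi, zmorphism X2 X1 psi,
        forall x, X1 x -> psi (phi x) = x &
        forall y, X2 y -> phi (psi y) = y].

(* On affine space every polynomial counts as a form of every degree. *)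
Definition affine_space (n : nat) : formSpace F :=
  @FormSpace F 'rV[F]_n
    (fun _ f => exists p : {mpoly F[n]}, forall x, f x = p.@[fun i => x 0 i]).

Variable V : vectType F.

Definition lin_coord (x : V) (i : 'I_(\dim {:V})) : F :=
  coord (vbasis {:V}) i x.

(** The Grassmannian [G(2,W)] of a subspace [W] of [V].  The ambient Pluecker
    coordinates are used: [P(Lambda^2 W)] is a linear subspace of
    [P(Lambda^2 V)]. *)
Definition gr2 (W : {vspace V}) : Type :=
  {U : {vspace V} | (U <= W)%VS && (\dim U == 2%N)}.

Definition pluecker (U : {vspace V}) : 'M[F]_(\dim {:V}) :=
  let u := lin_coord (vbasis U)`_0 in
  let v := lin_coord (vbasis U)`_1 in
  \matrix_(i, j) (u i * v j - u j * v i).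

Definition grassmannian2 (W : {vspace V}) : formSpace F :=
  @FormSpace F (gr2 W)
    (fun d f => exists2 p : {mpoly F[\dim {:V} * \dim {:V}]},
       p \is d.-homog &
       forall U, f U = p.@[fun m => mxvec (pluecker (val U)) 0 m]).

(* [z] lies in the Zariski tangent space at [x] of the subset [S] of [V]. *)
Definition tangent_at (S : V -> Prop) (x z : V) :=
  forall p : {mpoly F[\dim {:V}]},
    (forall y, S y -> p.@[lin_coord y] = 0) ->
    \sum_i (p^`M(i)).@[lin_coord x] * lin_coord z i = 0.

(** For a cone [S] in [V], points of the projectivization are lines [L] of [V].
    A contact of the plane [P(P)] with the projectivization of [S] at [L] is
    simple when the scheme-theoretic intersection is reduced there, that is,
    when the two tangent spaces meet only in the point [L] itself. *)
Definition proj_point (S : V -> Prop) (L : {vspace V}) :=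
  \dim L = 1%N /\ forall x, x \in L -> S x.

Definition simple_contact (S : V -> Prop) (P L : {vspace V}) :=
  forall x z, x \in L -> x != 0 -> z \in P -> tangent_at S x z -> z \in L.

Definition simply_3secant (S : V -> Prop) (P : {vspace V}) :=
  \dim P = 3%N /\
  exists s : seq {vspace V},
    [/\ uniq s, size s = 3%N,
        forall L, L \in s <-> proj_point S L /\ (L <= P)%VS &
        forall L, L \in s -> simple_contact S P L].

End Zariski.

(** * Composition algebras *)

(* Cayley-Dickson doubling of a field with trivial conjugation.  Over the reals
   the algebras [k = 0, 1, 2, 3] are R, C, H, O; over [R[i]] they are the
   complexifications of these, since the multiplication and conjugation are
   bilinear, resp. linear, and compatible with base change (cf. [cd_mul_map]
   and [cd_conj_map]). *)
Fixpoint cd_dim (k : nat) : nat :=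
  if k is k'.+1 then (cd_dim k' + cd_dim k')%N else 1%N.

Section CayleyDickson.
Variable F : fieldType.

Definition cd_alg (k : nat) := 'rV[F]_(cd_dim k).

Fixpoint cd_one (k : nat) : cd_alg k :=
  match k return cd_alg k with
  | 0%N => const_mx 1
  | k'.+1 => row_mx (cd_one k') 0
  end.

Fixpoint cd_conj (k : nat) : cd_alg k -> cd_alg k :=
  match k return cd_alg k -> cd_alg k with
  | 0%N => fun x => x
  | k'.+1 => fun x => row_mx (@cd_conj k' (lsubmx x)) (- rsubmx x)
  end.

(* (a,b)(c,d) = (ac - d^* b, da + b c^* ) *)
Fixpoint cd_mul (k : nat) : cd_alg k -> cd_alg k -> cd_alg k :=
  match k return cd_alg k -> cd_alg k -> cd_alg k with
  | 0%N => fun x y => \row_i (x 0 i * y 0 i)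
  | k'.+1 => fun x y =>
      let a : cd_alg k' := lsubmx x in let b : cd_alg k' := rsubmx x in
      let c : cd_alg k' := lsubmx y in let d : cd_alg k' := rsubmx y in
      row_mx (@cd_mul k' a c - @cd_mul k' (cd_conj d) b)
             (@cd_mul k' d a + @cd_mul k' b (cd_conj c))
  end.

End CayleyDickson.

Lemma cd_dimE k : cd_dim k = (2 ^ k)%N.
Proof. by elim: k => //= k ->; rewrite addnn expnS mul2n. Qed.

Lemma cd_conj_map (F E : fieldType) (f : {rmorphism F -> E}) k (x : cd_alg F k) :
  map_mx f (cd_conj x) = cd_conj (map_mx f x : cd_alg E k).
Proof.
elim: k x => //= k IHk x.
by rewrite map_row_mx map_mxN IHk map_lsubmx map_rsubmx.
Qed.

Lemma cd_mul_map (F E : fieldType) (f : {rmorphism F -> E}) k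
    (x y : cd_alg F k) :
  map_mx f (cd_mul x y) = cd_mul (map_mx f x : cd_alg E k) (map_mx f y).
Proof.
elim: k x y => [x y|k IHk x y] /=; first by apply/rowP => i; rewrite !mxE rmorphM.
by rewrite map_row_mx map_mxB map_mxD !IHk !cd_conj_map !map_lsubmx !map_rsubmx.
Qed.

(** * Hermitian matrices and the variety of reductions *)

Section Hermitian.
Variables (F : fieldType) (k : nat).

(* A Hermitian 3x3 matrix is given by its diagonal, with entries in [F], and its
   entries (0,1), (0,2), (1,2), stored in this order as the rows of the second
   component (so that the entry (i,j), i < j, is row i + j - 1). *)
Definition herm3 := ('rV[F]_3 * 'M[F]_(3, cd_dim k))%type.

Definition herm_entry (X : herm3) (i j : 'I_3) : cd_alg F k :=
  if i == j then X.1 0 i *: cd_one F k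
  else if (i < j)%N then row (inord (i + j).-1) X.2
  else cd_conj (row (inord (i + j).-1) X.2 : cd_alg F k).

Definition herm_tr (X : herm3) : F^o := \sum_i X.1 0 i.

Definition herm_id : herm3 := (const_mx 1, 0).

Lemma herm_tr_is_linear : linear herm_tr.
Proof.
move=> a X Y; rewrite /herm_tr scaler_sumr -big_split.
by apply: eq_bigr => i _; rewrite !mxE.
Qed.
HB.instance Definition _ :=
  GRing.isLinear.Build F herm3 F^o *:%R herm_tr herm_tr_is_linear.

Definition herm_traceless : {vspace herm3} := lker (linfun herm_tr).

(* Projection from the point [I]. *)
Definition herm_proj (X : herm3) : herm3 :=
  X - (3%:R^-1 * herm_tr X) *: herm_id.

Lemma herm_proj_is_linear : linear herm_proj.
Proof.
move=> a X Y; rewrite /herm_proj linearP mulrDr scalerDl scalerBr opprD.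
by rewrite addrACA scalerA mulrCA.
Qed.
HB.instance Definition _ :=
  GRing.isLinear.Build F herm3 herm3 *:%R herm_proj herm_proj_is_linear.

(* The cone X^2 = tr(X) X over the Severi variety. *)
Definition severi_cone (X : herm3) :=
  forall i j, \sum_l cd_mul (herm_entry X i l) (herm_entry X l j) =
              herm_tr X *: herm_entry X i j.

Definition reduction_line (U : grassmannian2 herm_traceless) :=
  exists P : {vspace herm3},
    [/\ simply_3secant severi_cone P, herm_id \in P &
        val U = (linfun herm_proj @: P)%VS].

Definition reductions : grassmannian2 herm_traceless -> Prop :=
  zclosure reduction_line.

End Hermitian.

(* Main.v *)
Require Import Defs.
From HB Require Import structures.
From mathcomp Require Import all_boot all_order all_algebra.
From mathcomp Require Import boolp reals complex mpoly ring.

(* By Cayley-Hamilton, the span of [1], [X], [X^2] is an associative subalgebra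
   for every Hermitian matrix [X]. When the characteristic polynomial of [X] has
   distinct roots, the spectral idempotents of [X] show that this plane is simply
   3-secant to the Severi variety; conversely every simply 3-secant plane through
   the identity is of this form for some [X]. Letting [X] vary, one may therefore
   replace reduction lines by those attached to a generic [X].

   In coordinates adapted to two isotropic vectors, Hermitian matrices become
   [[z, x, r], [y, b, x^*], [s, y^*, z^*]]. On the Pluecker chart given by [r] and
   a coordinate of [x], a line [U] has a unique basis [u1, u2] dual to these two
   linear forms. If [U] comes from a generic [X], the square of [u2] determines [u1],
   and solving for the entries shows that [u1] and [u2] are polynomial functions
   of [3 a] of their own coordinates. The graph of this polynomial map is closed in the
   chart, and its generic points are reduction lines, so it is the intersection
   of the variety of reductions with the chart. *)

Set Implicit Arguments.
Unset Strict Implicit.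
Unset Printing Implicit Defensive.

Import GRing.Theory Num.Theory.
Local Open Scope ring_scope.

(** * Cayley-Dickson composition algebras *)

Section CayleyDicksonTheory.
Variable F : fieldType.
Implicit Types k : nat.

Local Notation cd_l := (@lsubmx F 1 (cd_dim _) (cd_dim _)).
Local Notation cd_r := (@rsubmx F 1 (cd_dim _) (cd_dim _)).

Lemma cd_oneS k : cd_one F k.+1 = row_mx (cd_one F k) (0 : cd_alg F k).
Proof. by []. Qed.

Lemma cd_conjS k (x : cd_alg F k.+1) :
  cd_conj x = row_mx (cd_conj (cd_l x)) (- (cd_r x)).
Proof. by []. Qed.

Lemma cd_mulS k (x y : cd_alg F k.+1) :
  let a : cd_alg F k := cd_l x in let b : cd_alg F k := cd_r x in
  let c : cd_alg F k := cd_l y in let d : cd_alg F k := cd_r y in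
  cd_mul x y = row_mx (cd_mul a c - cd_mul (cd_conj d) b)
                      (cd_mul d a + cd_mul b (cd_conj c)).
Proof. by []. Qed.

Lemma cd_conj_is_linear k : linear (@cd_conj F k).
Proof.
elim: k => // k IH c x y.
by rewrite !cd_conjS !linearP IH scale_row_mx add_row_mx.
Qed.
HB.instance Definition _ k :=
  GRing.isLinear.Build F (cd_alg F k) (cd_alg F k) *:%R (@cd_conj F k)
    (@cd_conj_is_linear k).

Lemma cd_mul_bilinear k :
  (forall z : cd_alg F k, linear (@cd_mul F k ^~ z)) /\
  (forall z : cd_alg F k, linear (@cd_mul F k z)).
Proof.
elim: k => [|k [IHl IHr]] /=.
  by split=> z c x y; apply/rowP => i; rewrite !mxE; ring.
have Dl (z : cd_alg F k) (c : F) (x y : cd_alg F k) : cd_mul (c *: x + y) z = c *: cd_mul x z +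
    cd_mul y z by exact: (IHl z c x y).
have Dr (z : cd_alg F k) (c : F) (x y : cd_alg F k) : cd_mul z (c *: x + y) = c *: cd_mul z x +
    cd_mul z y by exact: (IHr z c x y).
split=> z c x y; rewrite !linearP /= !(Dl, Dr) scale_row_mx add_row_mx;
  by congr row_mx; apply/rowP=> i; rewrite !mxE; ring.
Qed.

Lemma cd_mulr_is_linear k (z : cd_alg F k) : linear (cd_mul z).
Proof. exact: (cd_mul_bilinear k).2. Qed.
HB.instance Definition _ k (z : cd_alg F k) :=
  GRing.isLinear.Build F (cd_alg F k) (cd_alg F k) *:%R (cd_mul z)
    (@cd_mulr_is_linear k z).

Lemma cd_mulDl k (x y z : cd_alg F k) : cd_mul (x + y) z = cd_mul x z + cd_mul y z.
Proof. by have := (cd_mul_bilinear k).1 z 1 x y; rewrite !scale1r. Qed.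

Lemma cd_mul0l k (z : cd_alg F k) : cd_mul 0 z = 0.
Proof. by apply: (addrI (cd_mul 0 z)); rewrite -cd_mulDl !addr0. Qed.

Lemma cd_mulZl k c (x z : cd_alg F k) : cd_mul (c *: x) z = c *: cd_mul x z.
Proof. by have := (cd_mul_bilinear k).1 z c x 0; rewrite !addr0 cd_mul0l addr0. Qed.

Lemma cd_mulNl k (x z : cd_alg F k) : cd_mul (- x) z = - cd_mul x z.
Proof. by rewrite -scaleN1r cd_mulZl scaleN1r. Qed.

Lemma cd_mulDr k (x y z : cd_alg F k) : cd_mul z (x + y) = cd_mul z x + cd_mul z y.
Proof. exact: linearD. Qed.

Lemma cd_mulZr k c (x z : cd_alg F k) : cd_mul z (c *: x) = c *: cd_mul z x.
Proof. exact: linearZ. Qed.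

Lemma cd_mulNr k (x z : cd_alg F k) : cd_mul z (- x) = - cd_mul z x.
Proof. exact: linearN. Qed.

Lemma cd_mul0r k (z : cd_alg F k) : cd_mul z 0 = 0.
Proof. exact: linear0. Qed.

Lemma cd_conjK k : involutive (@cd_conj F k).
Proof.
by elim: k => // k IH x; rewrite !cd_conjS row_mxKl row_mxKr IH opprK hsubmxK.
Qed.

Lemma cd_conj1 k : cd_conj (cd_one F k) = cd_one F k.
Proof. by elim: k => // k IH; rewrite cd_oneS cd_conjS row_mxKl row_mxKr IH oppr0. Qed.

Lemma cd_mul1 k (x : cd_alg F k) : cd_mul x (cd_one F k) = x /\ cd_mul (cd_one F k) x = x.
Proof.
elim: k x => [|k IH] x; first by split; apply/rowP => i; rewrite !mxE ?mulr1 ?mul1r.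
rewrite !cd_mulS cd_oneS row_mxKl row_mxKr cd_conj1 !raddf0 !cd_mul0l !(IH _).1 !(IH _).2.
by rewrite oppr0 !addr0 add0r hsubmxK.
Qed.

Lemma cd_mulr1 k (x : cd_alg F k) : cd_mul x (cd_one F k) = x.
Proof. exact: (cd_mul1 x).1. Qed.

Lemma cd_mul1r k (x : cd_alg F k) : cd_mul (cd_one F k) x = x.
Proof. exact: (cd_mul1 x).2. Qed.

Lemma cd_conjM k (x y : cd_alg F k) :
  cd_conj (cd_mul x y) = cd_mul (cd_conj y) (cd_conj x).
Proof.
elim: k x y => [|k IH] x y; first by apply/rowP => i; rewrite !mxE mulrC.
rewrite !(cd_conjS, cd_mulS) !row_mxKl !row_mxKr !raddfB /= !IH !cd_conjK !raddfN /= !cd_mulNl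
    ?cd_mulNr.
rewrite ?opprK ?linearN /= ?cd_mulNl ?cd_mulNr ?opprK; congr row_mx.
by rewrite opprD addrC.
Qed.

Definition cd_dot k (x y : cd_alg F k) : F := \sum_i x 0 i * y 0 i.
Definition cd_q k (x : cd_alg F k) : F := cd_dot x x.
(* The trace [x + x^*], as a scalar. *)
Definition cd_t k (x : cd_alg F k) : F := cd_dot x (cd_one F k) *+ 2.

Lemma cd_dotC k (x y : cd_alg F k) : cd_dot x y = cd_dot y x.
Proof. by apply: eq_bigr => i _; rewrite mulrC. Qed.

Lemma cd_dotDr k (x y z : cd_alg F k) : cd_dot z (x + y) = cd_dot z x + cd_dot z y.
Proof. by rewrite -big_split; apply: eq_bigr => i _; rewrite !mxE mulrDr. Qed.

Lemma cd_dotZr k c (x z : cd_alg F k) : cd_dot z (c *: x) = c * cd_dot z x.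
Proof. by rewrite mulr_sumr; apply: eq_bigr => i _; rewrite !mxE mulrCA. Qed.

Lemma cd_dotDl k (x y z : cd_alg F k) : cd_dot (x + y) z = cd_dot x z + cd_dot y z.
Proof. by rewrite cd_dotC cd_dotDr !(cd_dotC z). Qed.

Lemma cd_dotZl k c (x z : cd_alg F k) : cd_dot (c *: x) z = c * cd_dot x z.
Proof. by rewrite cd_dotC cd_dotZr (cd_dotC z). Qed.

Lemma cd_dotNr k (x z : cd_alg F k) : cd_dot z (- x) = - cd_dot z x.
Proof. by rewrite -scaleN1r cd_dotZr mulN1r. Qed.

Lemma cd_dotNl k (x z : cd_alg F k) : cd_dot (- x) z = - cd_dot x z.
Proof. by rewrite -scaleN1r cd_dotZl mulN1r. Qed.

Lemma cd_dot0r k (z : cd_alg F k) : cd_dot z 0 = 0.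
Proof. by rewrite -(scale0r 0) cd_dotZr mul0r. Qed.

Lemma cd_dot0l k (z : cd_alg F k) : cd_dot 0 z = 0.
Proof. by rewrite cd_dotC cd_dot0r. Qed.

Lemma cd_dot_nondeg k (x y : cd_alg F k) :
  (forall z, cd_dot x z = cd_dot y z) -> x = y.
Proof.
move=> h; apply/rowP => i; have := h (delta_mx 0 i).
rewrite /cd_dot (bigD1 i) //= [RHS](bigD1 i) //= !big1; last 2 first.
- by move=> j /negPf ne; rewrite !mxE ne andbF mulr0.
- by move=> j /negPf ne; rewrite !mxE ne andbF mulr0.
by rewrite !mxE !eqxx !mulr1 !addr0.
Qed.

Lemma cd_dot_row k (a b c d : cd_alg F k) :
  cd_dot (row_mx a b : cd_alg F k.+1) (row_mx c d) = cd_dot a c + cd_dot b d.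
Proof.
rewrite /cd_dot big_split_ord; congr (_ + _); apply: eq_bigr => i _.
  by rewrite !row_mxEl.
by rewrite !row_mxEr.
Qed.

Lemma cd_dot_conj k (x y : cd_alg F k) : cd_dot (cd_conj x) (cd_conj y) = cd_dot x y.
Proof.
elim: k x y => // k IH x y.
by rewrite !cd_conjS cd_dot_row IH cd_dotNl cd_dotNr opprK -cd_dot_row !hsubmxK.
Qed.

Lemma cd_dot_conjl k (x y : cd_alg F k) : cd_dot (cd_conj x) y = cd_dot x (cd_conj y).
Proof. by rewrite -(cd_dot_conj x) cd_conjK. Qed.

Lemma cd_dot_mull k (x y z : cd_alg F k) :
  cd_dot (cd_mul x y) z = cd_dot y (cd_mul (cd_conj x) z).
Proof.
elim: k x y z => [|k IH] x y z.
  by apply: eq_bigr => i _; rewrite !mxE; ring.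
have IH' (u v w : cd_alg F k) : cd_dot (cd_mul u v) w = cd_dot u (cd_mul w (cd_conj v)).
  by rewrite -(cd_dot_conj (cd_mul u v)) cd_conjM IH cd_conjK cd_dot_conjl cd_conjM cd_conjK.
rewrite -[z in LHS]hsubmxK -[y in RHS]hsubmxK !(cd_mulS, cd_conjS) !cd_dot_row ?row_mxKl ?row_mxKr.
rewrite !cd_dotDl !cd_dotDr ?cd_dotNl ?cd_dotNr ?cd_conjK ?cd_mulNr ?cd_mulNl ?cd_dotNr ?opprK.
set a := cd_l x; set b := cd_r x; set c := cd_l y; set d := cd_r y.
set e := cd_l z; set f := cd_r z.
rewrite (IH a c e).
have -> : cd_dot (cd_mul (cd_conj d) b) e = cd_dot d (cd_mul b (cd_conj e)).
  by rewrite IH' cd_dot_conjl cd_conjM cd_conjK.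
rewrite (IH' d a f).
have -> : cd_dot (cd_mul b (cd_conj c)) f = cd_dot c (cd_mul (cd_conj f) b).
  by rewrite IH cd_dot_conjl cd_conjM cd_conjK.
by ring.
Qed.

Lemma cd_dot_mulr k (x y z : cd_alg F k) :
  cd_dot (cd_mul x y) z = cd_dot x (cd_mul z (cd_conj y)).
Proof.
by rewrite -(cd_dot_conj (cd_mul x y)) cd_conjM cd_dot_mull cd_conjK cd_dot_conjl cd_conjM
  cd_conjK.
Qed.

Lemma cd_mulrC01 k (x y : cd_alg F k) : (k <= 1)%N -> cd_mul x y = cd_mul y x.
Proof.
have h0 (u v : cd_alg F 0) : cd_mul u v = cd_mul v u.
  by apply/rowP => i; rewrite !mxE mulrC.
case: k x y => [|[|//]] x y _; first exact: h0.
have c0 (u : cd_alg F 0) : cd_conj u = u by [].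
rewrite !cd_mulS !c0; congr row_mx; last by rewrite addrC.
by congr (_ - _); apply: h0.
Qed.

Lemma cd_mulrA k (x y z : cd_alg F k) :
  (k <= 2)%N -> cd_mul x (cd_mul y z) = cd_mul (cd_mul x y) z.
Proof.
elim: k x y z => [|k IH] x y z hk; first by apply/rowP => i; rewrite !mxE mulrA.
have A u v w := IH u v w (ltnW hk); have C u v := @cd_mulrC01 k u v hk.
rewrite !cd_mulS !row_mxKl !row_mxKr !(raddfB, raddfD) /= !cd_conjM !cd_conjK.
rewrite !(cd_mulDl, cd_mulDr, cd_mulNl, cd_mulNr).
set a := cd_l x; set b := cd_r x; set c := cd_l y; set d := cd_r y.
set e := cd_l z; set f := cd_r z; set c' := cd_conj c; set d' := cd_conj d.
set e' := cd_conj e; set f' := cd_conj f.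
have -> : cd_mul a (cd_mul f' d) = cd_mul f' (cd_mul d a) by rewrite A (C a) -A (C a).
have -> : cd_mul (cd_mul c' f') b = cd_mul f' (cd_mul b c') by rewrite (C c') -A (C c').
have -> : cd_mul (cd_mul e d') b = cd_mul (cd_mul d' b) e by rewrite -A C.
have -> : cd_mul (cd_mul f c) a = cd_mul f (cd_mul a c) by rewrite -A (C c).
have -> : cd_mul (cd_mul d e') a = cd_mul (cd_mul d a) e' by rewrite -!A (C e').
have -> : cd_mul b (cd_mul e' c') = cd_mul (cd_mul b c') e' by rewrite (C e') A.
have -> : cd_mul b (cd_mul d' f) = cd_mul f (cd_mul d' b) by rewrite A (C _ f) (C b).
rewrite A.
by congr row_mx; apply/rowP => i; rewrite !mxE; ring.
Qed.

Lemma cd_qM k (x y : cd_alg F k) : (k <= 3)%N -> cd_q (cd_mul x y) = cd_q x * cd_q y.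
Proof.
have qc j (u : cd_alg F j) : cd_q (cd_conj u) = cd_q u by exact: cd_dot_conj.
elim: k x y => [|k IH] x y hk.
  by rewrite /cd_q /cd_dot !big_ord1 !mxE; ring.
have Q u v := IH u v (ltnW hk); have A u v w := @cd_mulrA k u v w hk.
rewrite /cd_q -[x in RHS]hsubmxK -[y in RHS]hsubmxK cd_mulS !cd_dot_row.
rewrite !cd_dotDl !cd_dotDr !cd_dotNl !cd_dotNr -!/(cd_q _) !Q !qc.
set a := cd_l x; set b := cd_r x; set c := cd_l y; set d := cd_r y.
rewrite (cd_dotC (cd_mul (cd_conj d) b)) (cd_dotC (cd_mul b (cd_conj c))).
have -> : cd_dot (cd_mul d a) (cd_mul b (cd_conj c)) = cd_dot (cd_mul a c) (cd_mul (cd_conj d) b).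
  by rewrite -[in RHS](cd_conjK d) -cd_dot_mull cd_conjK A [RHS]cd_dot_mulr.
by rewrite /cd_q; ring.
Qed.

End CayleyDicksonTheory.

Section CompositionAlgebra.
Variable F : numClosedFieldType.
Variable k : nat.
Implicit Types x y z w : cd_alg F k.

Lemma cd_conjD x y : cd_conj (x + y) = cd_conj x + cd_conj y.
Proof. exact: linearD. Qed.
Lemma cd_conjZ c x : cd_conj (c *: x) = c *: cd_conj x.
Proof. exact: linearZ. Qed.
Lemma cd_conjN x : cd_conj (- x) = - cd_conj x.
Proof. exact: linearN. Qed.
Lemma cd_conj0 : cd_conj (0 : cd_alg F k) = 0.
Proof. exact: linear0. Qed.

Lemma cd_addC x : x + cd_conj x = cd_t x *: cd_one F k.
Proof.
elim: k x => [|j IH] x.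
  apply/rowP => i; rewrite (ord1 i) !mxE /cd_t /cd_dot big_ord1 !mxE; ring.
rewrite cd_conjS cd_oneS -{1}[x]hsubmxK add_row_mx subrr IH scale_row_mx scaler0.
by rewrite /cd_t -[x in RHS]hsubmxK cd_dot_row cd_dot0r addr0.
Qed.

Lemma cd_conjE x : cd_conj x = cd_t x *: cd_one F k - x.
Proof. by rewrite -cd_addC addrC addKr. Qed.

Lemma cd_q_conj x : cd_q (cd_conj x) = cd_q x.
Proof. exact: cd_dot_conj. Qed.

Lemma cd_q1 : cd_q (cd_one F k) = 1.
Proof.
elim: k => [|j IH]; first by rewrite /cd_q /cd_dot big_ord1 !mxE mulr1.
by rewrite /cd_q cd_oneS cd_dot_row -/(cd_q _) IH cd_dot0r addr0.
Qed.

Lemma cd_one_neq0 : cd_one F k != 0.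
Proof. by apply/eqP => e; have := cd_q1; rewrite e /cd_q cd_dot0r => /esym/eqP; rewrite oner_eq0.
    Qed.

Lemma cd_mulC_dot x y : cd_mul x (cd_conj y) + cd_mul y (cd_conj x) = (cd_dot x y *+ 2) *: cd_one
    F k.
Proof.
rewrite -[cd_mul y _]cd_conjK cd_conjM cd_conjK cd_addC /cd_t.
by rewrite cd_dotC -cd_dot_mulr cd_mul1r cd_dotC.
Qed.

Lemma cd_mul_conjr x : cd_mul x (cd_conj x) = cd_q x *: cd_one F k.
Proof.
have := cd_mulC_dot x x; rewrite -mulr2n -scaler_nat => e.
apply: (@scalerI F _ 2%:R); first by rewrite pnatr_eq0.
by rewrite e scalerA mulr_natl.
Qed.

Lemma cd_t_conj x : cd_t (cd_conj x) = cd_t x.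
Proof. by rewrite /cd_t cd_dot_conjl cd_conj1. Qed.

Lemma cd_tM x y : cd_t (cd_mul x y) = cd_dot x (cd_conj y) *+ 2.
Proof. by rewrite /cd_t cd_dot_mulr cd_mul1r. Qed.

Lemma cd_sqr x : cd_mul x x = cd_t x *: x - cd_q x *: cd_one F k.
Proof.
by rewrite -[x in cd_mul _ x]cd_conjK [cd_conj (cd_conj x)]cd_conjE cd_t_conj
  cd_mulDr cd_mulNr cd_mulZr cd_mulr1 cd_mul_conjr.
Qed.

Hypothesis hk : (k <= 3)%N.

Lemma cd_dotMl x y z : cd_dot (cd_mul x y) (cd_mul x z) = cd_q x * cd_dot y z.
Proof.
have := cd_qM x (y + z) hk; rewrite cd_mulDr /cd_q !cd_dotDl !cd_dotDr.
rewrite -!/(cd_q _) !cd_qM // (cd_dotC z) (cd_dotC (cd_mul x z)) => e.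
apply: (@mulfI _ (2%:R : F)); first by rewrite pnatr_eq0.
by apply/eqP; rewrite -subr_eq0; move/eqP: e; rewrite -subr_eq0 => /eqP <-; apply/eqP; ring.
Qed.

Lemma cd_dotMr x y z : cd_dot (cd_mul y x) (cd_mul z x) = cd_q x * cd_dot y z.
Proof. by rewrite -cd_dot_conj !cd_conjM cd_dotMl cd_dot_conj cd_q_conj. Qed.

Lemma cd_mulVK x y : cd_mul (cd_conj x) (cd_mul x y) = cd_q x *: y.
Proof.
by apply: cd_dot_nondeg => z; rewrite cd_dot_mull cd_conjK cd_dotMl cd_dotZl.
Qed.

Lemma cd_mulKV x y : cd_mul x (cd_mul (cd_conj x) y) = cd_q x *: y.
Proof. by rewrite -{1}[x]cd_conjK cd_mulVK cd_q_conj. Qed.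

Lemma cd_mulrK x y : cd_mul (cd_mul y x) (cd_conj x) = cd_q x *: y.
Proof. by apply: (can_inj (@cd_conjK F k)); rewrite !cd_conjM cd_conjK cd_mulKV linearZ. Qed.

Lemma cd_mulrVK x y : cd_mul (cd_mul y (cd_conj x)) x = cd_q x *: y.
Proof. by rewrite -{2}[x]cd_conjK cd_mulrK cd_q_conj. Qed.

Lemma cd_dot_exchange x y z w :
  cd_dot (cd_mul x y) (cd_mul z w) + cd_dot (cd_mul x w) (cd_mul z y)
  = cd_dot x z * cd_dot y w *+ 2.
Proof.
have := cd_dotMl (x + z) y w; rewrite !cd_mulDl !cd_dotDl !cd_dotDr !cd_dotMl.
rewrite /cd_q !cd_dotDl !cd_dotDr -!/(cd_q _) (cd_dotC z x).
rewrite (cd_dotC (cd_mul z y)) => e.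
apply/eqP; rewrite -subr_eq0; move/eqP: e; rewrite -subr_eq0 => /eqP <-; apply/eqP; ring.
Qed.

Lemma cd_moufang x w y :
  cd_mul (cd_mul x w) (cd_mul y x)
  = (cd_dot x (cd_conj (cd_mul w y)) *+ 2) *: x - cd_q x *: cd_conj (cd_mul w y).
Proof.
apply: cd_dot_nondeg => z.
rewrite cd_dot_mulr cd_conjM cd_dotDl cd_dotNl !cd_dotZl.
have := cd_dot_exchange x w z (cd_mul (cd_conj x) (cd_conj y)).
rewrite cd_mulKV cd_dotZl -(cd_conjK x) -cd_dot_mull cd_conjK cd_conjM.
have -> : cd_dot (cd_mul x w) (cd_conj y) = cd_dot x (cd_mul (cd_conj y) (cd_conj w)).
  by rewrite cd_dot_mulr.
have -> : cd_dot (cd_conj y) (cd_mul z w) = cd_dot (cd_mul (cd_conj y) (cd_conj w)) z.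
  by rewrite cd_dot_mulr cd_conjK.
move/eqP; rewrite -subr_eq0 => /eqP e; apply/eqP; rewrite -subr_eq0 -{}[X in _ == X]e.
by apply/eqP; ring.
Qed.

End CompositionAlgebra.

(** * The Jordan algebra of Hermitian matrices *)

Section Jordan.
Variable F : numClosedFieldType.
Variable k : nat.
Local Notation A := (cd_alg F k).
Local Notation J := (herm3 F k).
Implicit Types X Y Z : J.

(* [hoff 0], [hoff 1], [hoff 2] are the entries (0,1), (0,2), (1,2). *)
Definition hdiag (j : nat) X : F := X.1 0 (inord j).
Definition hoff (j : nat) X : A := row (inord j) X.2.

Definition mkH (a b c : F) (x y z : A) : J :=
  (\row_i [:: a; b; c]`_i, \matrix_(i, j) ([:: x; y; z]`_i : A) 0 j).

Lemma ord3P (P : 'I_3 -> Prop) :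
  P (inord 0) -> P (inord 1) -> P (inord 2) -> forall i, P i.
Proof.
move=> h0 h1 h2 [m lt]; have -> : Ordinal lt = inord m by apply: val_inj; rewrite /= inordK.
by case: m lt => [|[|[|//]]].
Qed.

Lemma sum3E (V : zmodType) (f : 'I_3 -> V) :
  \sum_i f i = f (inord 0) + f (inord 1) + f (inord 2).
Proof.
rewrite !big_ord_recl big_ord0 addr0 addrA.
by congr (f _ + f _ + f _); apply: val_inj; rewrite /= inordK.
Qed.

Lemma hermP X Y : hdiag 0 X = hdiag 0 Y -> hdiag 1 X = hdiag 1 Y -> hdiag 2 X = hdiag 2 Y ->
  hoff 0 X = hoff 0 Y -> hoff 1 X = hoff 1 Y -> hoff 2 X = hoff 2 Y -> X = Y.
Proof.
case: X Y => [d M] [d' M'] a0 a1 a2 b0 b1 b2; congr pair.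
  by apply/rowP; apply: ord3P.
by apply/row_matrixP; apply: ord3P.
Qed.

Section Components.
Variables (a b c : F) (x y z : A).
Let M := mkH a b c x y z.
Lemma hdiag0_mkH : hdiag 0 M = a. Proof. by rewrite /hdiag mxE inordK. Qed.
Lemma hdiag1_mkH : hdiag 1 M = b. Proof. by rewrite /hdiag mxE inordK. Qed.
Lemma hdiag2_mkH : hdiag 2 M = c. Proof. by rewrite /hdiag mxE inordK. Qed.
Lemma hoff0_mkH : hoff 0 M = x. Proof. by apply/rowP => i; rewrite !mxE inordK. Qed.
Lemma hoff1_mkH : hoff 1 M = y. Proof. by apply/rowP => i; rewrite !mxE inordK. Qed.
Lemma hoff2_mkH : hoff 2 M = z. Proof. by apply/rowP => i; rewrite !mxE inordK. Qed.
End Components.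
Definition mkHE := (hdiag0_mkH, hdiag1_mkH, hdiag2_mkH, hoff0_mkH, hoff1_mkH, hoff2_mkH).

Lemma hdiagD j X Y : hdiag j (X + Y) = hdiag j X + hdiag j Y. Proof. exact: mxE. Qed.
Lemma hdiagZ j c X : hdiag j (c *: X) = c * hdiag j X. Proof. exact: mxE. Qed.
Lemma hdiagN j X : hdiag j (- X) = - hdiag j X. Proof. exact: mxE. Qed.
Lemma hdiag0 j : hdiag j 0 = 0. Proof. exact: mxE. Qed.
Lemma hoffD j X Y : hoff j (X + Y) = hoff j X + hoff j Y. Proof. exact: linearD. Qed.
Lemma hoffZ j c X : hoff j (c *: X) = c *: hoff j X. Proof. exact: linearZ. Qed.
Lemma hoffN j X : hoff j (- X) = - hoff j X. Proof. exact: linearN. Qed.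
Lemma hoff0 j : hoff j 0 = 0. Proof. exact: linear0. Qed.
Lemma hdiag_id j : hdiag j (herm_id F k) = 1. Proof. exact: mxE. Qed.
Lemma hoff_id j : hoff j (herm_id F k) = 0. Proof. exact: linear0. Qed.
Definition hcompE := (hdiagD, hdiagZ, hdiagN, hoffD, hoffZ, hoffN, hdiag_id, hoff_id, hdiag0,
    hoff0).

Lemma herm_trE X : herm_tr X = hdiag 0 X + hdiag 1 X + hdiag 2 X.
Proof. exact: sum3E. Qed.

Lemma herm_trD X Y : herm_tr (X + Y) = herm_tr X + herm_tr Y.
Proof. exact: linearD. Qed.
Lemma herm_trZ c X : herm_tr (c *: X) = c * herm_tr X.
Proof. exact: linearZ. Qed.

Lemma herm_tr_id : herm_tr (herm_id F k) = 3%:R.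
Proof. by rewrite herm_trE !hdiag_id; ring. Qed.

Definition jp X Y : J := mkH
  (hdiag 0 X * hdiag 0 Y + cd_dot (hoff 0 X) (hoff 0 Y) + cd_dot (hoff 1 X) (hoff 1 Y))
  (hdiag 1 X * hdiag 1 Y + cd_dot (hoff 0 X) (hoff 0 Y) + cd_dot (hoff 2 X) (hoff 2 Y))
  (hdiag 2 X * hdiag 2 Y + cd_dot (hoff 1 X) (hoff 1 Y) + cd_dot (hoff 2 X) (hoff 2 Y))
  (2%:R^-1 *: ((hdiag 0 X + hdiag 1 X) *: hoff 0 Y + (hdiag 0 Y + hdiag 1 Y) *: hoff 0 X
     + (cd_mul (hoff 1 X) (cd_conj (hoff 2 Y)) + cd_mul (hoff 1 Y) (cd_conj (hoff 2 X)))))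
  (2%:R^-1 *: ((hdiag 0 X + hdiag 2 X) *: hoff 1 Y + (hdiag 0 Y + hdiag 2 Y) *: hoff 1 X
     + (cd_mul (hoff 0 X) (hoff 2 Y) + cd_mul (hoff 0 Y) (hoff 2 X))))
  (2%:R^-1 *: ((hdiag 1 X + hdiag 2 X) *: hoff 2 Y + (hdiag 1 Y + hdiag 2 Y) *: hoff 2 X
     + (cd_mul (cd_conj (hoff 0 X)) (hoff 1 Y) + cd_mul (cd_conj (hoff 0 Y)) (hoff 1 X)))).

Lemma jpC X Y : jp X Y = jp Y X.
Proof.
rewrite /jp; congr mkH; rewrite ?(cd_dotC (hoff 0 X)) ?(cd_dotC (hoff 1 X)) ?(cd_dotC (hoff 2 X)).
all: try by ring.
all: by congr (_ *: (_ + _)); rewrite addrC.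
Qed.

Lemma jp_linear X : linear (jp X).
Proof.
move=> c Y Z; apply: hermP; rewrite !(mkHE, hcompE) ?(cd_dotDr, cd_dotZr); try by ring.
all: rewrite ?(cd_conjD, cd_conjZ) !(cd_mulDl, cd_mulDr, cd_mulZl, cd_mulZr).
all: by apply/rowP => i; rewrite !mxE; ring.
Qed.
HB.instance Definition _ X :=
  GRing.isLinear.Build F J J *:%R (jp X) (@jp_linear X).

Lemma jpDr X Y Z : jp X (Y + Z) = jp X Y + jp X Z. Proof. exact: linearD. Qed.
Lemma jpZr X c Y : jp X (c *: Y) = c *: jp X Y. Proof. exact: linearZ. Qed.
Lemma jpNr X Y : jp X (- Y) = - jp X Y. Proof. exact: linearN. Qed.
Lemma jp_sumr X (I : finType) (f : I -> J) : jp X (\sum_i f i) = \sum_i jp X (f i).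
Proof. exact: linear_sum. Qed.
Lemma jpDl X Y Z : jp (Y + Z) X = jp Y X + jp Z X. Proof. by rewrite !(jpC _ X) jpDr. Qed.
Lemma jpZl X c Y : jp (c *: Y) X = c *: jp Y X. Proof. by rewrite !(jpC _ X) jpZr. Qed.
Lemma jpNl X Y : jp (- Y) X = - jp Y X. Proof. by rewrite !(jpC _ X) jpNr. Qed.
Definition jpE := (jpDl, jpDr, jpZl, jpZr, jpNl, jpNr).

Lemma jp_id X : jp (herm_id F k) X = X.
Proof.
apply: hermP; rewrite !(mkHE, hcompE) ?cd_dot0l; try by ring.
all: rewrite ?cd_conj0 ?cd_mul0l ?cd_mul0r; apply/rowP => i; rewrite !mxE.
all: by field.
Qed.

Lemma scaler_half2 (v : A) : 2%:R^-1 *: (v + v) = v.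
Proof. by apply/rowP => i; rewrite !mxE; field. Qed.

Lemma jp_sqE X : jp X X = mkH
  (hdiag 0 X ^+ 2 + cd_q (hoff 0 X) + cd_q (hoff 1 X))
  (hdiag 1 X ^+ 2 + cd_q (hoff 0 X) + cd_q (hoff 2 X))
  (hdiag 2 X ^+ 2 + cd_q (hoff 1 X) + cd_q (hoff 2 X))
  ((hdiag 0 X + hdiag 1 X) *: hoff 0 X + cd_mul (hoff 1 X) (cd_conj (hoff 2 X)))
  ((hdiag 0 X + hdiag 2 X) *: hoff 1 X + cd_mul (hoff 0 X) (hoff 2 X))
  ((hdiag 1 X + hdiag 2 X) *: hoff 2 X + cd_mul (cd_conj (hoff 0 X)) (hoff 1 X)).
Proof. by rewrite /jp; congr mkH; rewrite // addrACA scaler_half2. Qed.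

Lemma herm_entryE X :
  (forall j, (j < 3)%N -> herm_entry X (inord j) (inord j) = hdiag j X *: cd_one F k) /\
  (forall i j, (i < j < 3)%N -> herm_entry X (inord i) (inord j) = hoff (i + j).-1 X
     /\ herm_entry X (inord j) (inord i) = cd_conj (hoff (i + j).-1 X)).
Proof.
split=> [j _|i j /andP[ij j3]]; first by rewrite /herm_entry eqxx.
have i3 := ltn_trans ij j3.
have ne : (inord i == inord j :> 'I_3) = false.
  by apply/negP => /eqP/(congr1 val); rewrite /= !inordK // => e; rewrite e ltnn in ij.
split; first by rewrite /herm_entry ne !inordK // ij.
by rewrite /herm_entry eq_sym ne !inordK // ltnNge (ltnW ij) /= addnC.
Qed.

Lemma severi_coneE X : severi_cone X <-> jp X X = herm_tr X *: X.
Proof.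
have [hD hO] := herm_entryE X; have d0 := hD 0%N isT; have d1 := hD 1%N isT.
have d2 := hD 2%N isT; have [a01 a10] := hO 0%N 1%N isT.
have [a02 a20] := hO 0%N 2%N isT; have [a12 a21] := hO 1%N 2%N isT.
have E := (d0, d1, d2, a01, a10, a02, a20, a12, a21).
have cm := @cd_mul_conjr F k.
have cm' (x : A) : cd_mul (cd_conj x) x = cd_q x *: cd_one F k.
  by rewrite -{2}[x]cd_conjK cm cd_q_conj.
have one_inj (c d : F) : c *: cd_one F k = d *: cd_one F k -> c = d.
  move/eqP; rewrite -subr_eq0 -scalerBl scaler_eq0 (negPf (cd_one_neq0 F k)) orbF subr_eq0.
  by move/eqP.
split=> [h|h].
  apply: hermP; rewrite jp_sqE !mkHE !hcompE.
  - have := h (inord 0) (inord 0); rewrite sum3E !E !cm cd_mulZl cd_mulZr cd_mulr1 !scalerA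
      -!scalerDl.
    by move/one_inj => <-; rewrite expr2.
  - have := h (inord 1) (inord 1); rewrite sum3E !E !cm !cm' cd_mulZl cd_mulZr cd_mulr1 !scalerA
      -!scalerDl.
    by move/one_inj => <-; ring.
  - have := h (inord 2) (inord 2); rewrite sum3E !E !cm' cd_mulZl cd_mulZr cd_mulr1 !scalerA
      -!scalerDl.
    by move/one_inj => <-; ring.
  - have := h (inord 0) (inord 1); rewrite sum3E !E !cd_mulZl !cd_mulZr cd_mulr1 cd_mul1r => <-.
    by rewrite scalerDl.
  - have := h (inord 0) (inord 2); rewrite sum3E !E !cd_mulZl !cd_mulZr cd_mulr1 cd_mul1r => <-.
    by rewrite scalerDl addrAC.
  - have := h (inord 1) (inord 2); rewrite sum3E !E !cd_mulZl !cd_mulZr cd_mulr1 cd_mul1r => <-.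
    by rewrite scalerDl addrC addrA.
have e0 := congr1 (hdiag 0) h; have e1 := congr1 (hdiag 1) h; have e2 := congr1 (hdiag 2) h.
have f0 := congr1 (hoff 0) h; have f1 := congr1 (hoff 1) h; have f2 := congr1 (hoff 2) h.
rewrite jp_sqE !mkHE !hcompE in e0 e1 e2 f0 f1 f2.
have g0 := congr1 (@cd_conj F k) f0; have g1 := congr1 (@cd_conj F k) f1.
have g2 := congr1 (@cd_conj F k) f2.
rewrite cd_conjD !cd_conjZ cd_conjM ?cd_conjK in g0.
rewrite cd_conjD !cd_conjZ cd_conjM ?cd_conjK in g1.
rewrite cd_conjD !cd_conjZ cd_conjM ?cd_conjK in g2.
apply: ord3P; apply: ord3P; rewrite sum3E !E ?cm ?cm' !(cd_mulZl, cd_mulZr) ?cd_mulr1 ?cd_mul1r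
    ?scalerA -?scalerDl.
- by congr (_ *: _); rewrite -e0 expr2.
- by rewrite -f0 scalerDl.
- by rewrite -f1 scalerDl addrAC.
- by rewrite -g0 scalerDl.
- by congr (_ *: _); rewrite -e1; ring.
- by rewrite -f2 scalerDl -addrA addrC.
- by rewrite -g1 scalerDl addrAC.
- by rewrite -g2 scalerDl -addrA addrC.
- by congr (_ *: _); rewrite -e2; ring.
Qed.

End Jordan.

Section CayleyHamilton.
Variable F : numClosedFieldType.
Variable k : nat.
Hypothesis hk : (k <= 3)%N.
Local Notation A := (cd_alg F k).
Local Notation J := (herm3 F k).
Implicit Types X : J.

Definition herm_s X : F :=
  hdiag 0 X * hdiag 1 X + hdiag 0 X * hdiag 2 X + hdiag 1 X * hdiag 2 X
  - cd_q (hoff 0 X) - cd_q (hoff 1 X) - cd_q (hoff 2 X).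
Definition herm_det X : F :=
  hdiag 0 X * hdiag 1 X * hdiag 2 X - hdiag 0 X * cd_q (hoff 2 X) - hdiag 1 X * cd_q (hoff 1 X)
  - hdiag 2 X * cd_q (hoff 0 X) + cd_dot (cd_mul (hoff 0 X) (hoff 2 X)) (hoff 1 X) *+ 2.

Let dots (x y z : A) :
  (cd_dot x (cd_mul y (cd_conj z)) = cd_dot (cd_mul x z) y) *
  (cd_dot y (cd_mul x z) = cd_dot (cd_mul x z) y) *
  (cd_dot z (cd_mul (cd_conj x) y) = cd_dot (cd_mul x z) y).
Proof. by split; [split; [rewrite -cd_dot_mulr | rewrite cd_dotC] | rewrite -cd_dot_mull]. Qed.

Let conj_mulr (x y : A) : cd_conj (cd_mul x (cd_conj y)) = cd_mul y (cd_conj x).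
Proof. by rewrite cd_conjM cd_conjK. Qed.

Let conj_mull (x y : A) : cd_conj (cd_mul (cd_conj x) y) = cd_mul (cd_conj y) x.
Proof. by rewrite cd_conjM cd_conjK. Qed.

Lemma cayley_hamilton X :
  jp X (jp X X) = herm_tr X *: jp X X - herm_s X *: X + herm_det X *: herm_id F k.
Proof.
rewrite [jp X (jp _ _)]/jp !jp_sqE !mkHE herm_trE.
apply: hermP; rewrite !mkHE !hcompE !mkHE /herm_s /herm_det.
1-3: rewrite !cd_dotDr !cd_dotZr !(dots (hoff 0 X) (hoff 1 X) (hoff 2 X)) -!/(cd_q _); ring.
all: rewrite ?cd_conjD ?cd_conjZ ?conj_mulr ?conj_mull ?cd_conjK !(cd_mulDl, cd_mulDr, cd_mulZl,
    cd_mulZr).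
all: rewrite ?(cd_mulrK hk) ?(cd_mulKV hk) ?(cd_mulVK hk) ?(cd_mulrVK hk).
all: by apply/rowP => i; rewrite !mxE; field.
Qed.

Lemma jp_power_assoc X :
  jp (jp X X) (jp X X) = (herm_tr X ^+ 2 - herm_s X) *: jp X X
    + (herm_det X - herm_tr X * herm_s X) *: X + (herm_tr X * herm_det X) *: herm_id F k.
Proof.
rewrite [jp (jp _ _) _]jp_sqE !jp_sqE !mkHE herm_trE.
apply: hermP; rewrite !mkHE !hcompE !mkHE /herm_s /herm_det.
1-3: rewrite /cd_q !cd_dotDr !cd_dotDl !cd_dotZr !cd_dotZl -!/(cd_q _) !(cd_qM _ _ hk) !cd_q_conj.
1-3: rewrite ?(cd_dotC (cd_mul (hoff 1 X) _)) ?(cd_dotC (cd_mul (cd_conj _) _)) ?(dots (hoff 0 X)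
    (hoff 1 X) (hoff 2 X)); ring.
all: rewrite ?cd_conjD ?cd_conjZ ?conj_mulr ?conj_mull ?cd_conjK !(cd_mulDl, cd_mulDr, cd_mulZl,
    cd_mulZr).
all: rewrite ?(cd_mulrK hk) ?(cd_mulKV hk) ?(cd_mulVK hk) ?(cd_mulrVK hk) (cd_moufang hk).
all: rewrite !(cd_conjM, cd_conjK) !(dots (hoff 0 X) (hoff 1 X) (hoff 2 X)).
all: by apply/rowP => i; rewrite !mxE; ring.
Qed.

End CayleyHamilton.

(** * Isotropic coordinates *)

Section IsotropicCoordinates.
Variable F : numClosedFieldType.
Variable k : nat.
Hypothesis hk : (k <= 3)%N.
Local Notation A := (cd_alg F k).
Local Notation J := (herm3 F k).
Local Notation one := (cd_one F k).
Implicit Types (b r s : F) (x y z : A).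

(* [S N S^T] for the Hermitian matrix [N = [[r, x, z], [x^*, b, y], [z^*, y^*, s]]],
   where the columns of [S] are [(1, i, 0)], [(0, 0, 1)] and [(1, -i, 0) / 2].
   As [S K S^T = 1] for the antidiagonal [K], the Jordan product becomes that
   of the matrices [N K = [[z, x, r], [y, b, x^*], [s, y^*, z^*]]]. *)
Definition kf b r s z x y : J :=
  mkH (r + cd_dot z one + s / 4%:R) (- r + cd_dot z one - s / 4%:R) b
      (('i * (r - s / 4%:R)) *: one + ('i / 2%:R) *: (cd_conj z - z))
      (x + 2%:R^-1 *: cd_conj y) ('i *: x - ('i / 2%:R) *: cd_conj y).

Lemma kf_id : herm_id F k = kf 1 0 0 one 0 0.
Proof.
have := cd_q1 F k; rewrite /cd_q => q1.
apply: hermP; rewrite !mkHE !hcompE ?cd_conj1 ?cd_conj0 ?q1 ?subrr ?scaler0 ?subr0 ?addr0 //; try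
    ring.
by rewrite mul0r subrr mulr0 scale0r.
Qed.

Lemma kf_linear c b r s z x y b' r' s' z' x' y' :
  kf (c * b + b') (c * r + r') (c * s + s') (c *: z + z') (c *: x + x') (c *: y + y')
  = c *: kf b r s z x y + kf b' r' s' z' x' y'.
Proof.
apply: hermP; rewrite !(mkHE, hcompE) ?cd_dotDl ?cd_dotZl ?cd_conjD ?cd_conjZ; try by ring.
all: by apply/rowP => i; rewrite !mxE; ring.
Qed.

Lemma kfD b r s z x y b' r' s' z' x' y' :
  kf b r s z x y + kf b' r' s' z' x' y'
  = kf (b + b') (r + r') (s + s') (z + z') (x + x') (y + y').
Proof. by have := kf_linear 1 b r s z x y b' r' s' z' x' y'; rewrite !mul1r !scale1r. Qed.

Lemma kf0 : kf 0 0 0 0 0 0 = 0.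
Proof. by apply: (addrI (kf 0 0 0 0 0 0)); rewrite kfD !addr0. Qed.

Lemma kfZ c b r s z x y :
  c *: kf b r s z x y = kf (c * b) (c * r) (c * s) (c *: z) (c *: x) (c *: y).
Proof. by have := kf_linear c b r s z x y 0 0 0 0 0 0; rewrite kf0 !addr0. Qed.

Lemma kf_tr b r s z x y : herm_tr (kf b r s z x y) = b + cd_t z.
Proof. by rewrite herm_trE !mkHE /cd_t; ring. Qed.

Lemma kf_sq b r s z x y :
  jp (kf b r s z x y) (kf b r s z x y) =
  kf (b ^+ 2 + cd_t (cd_mul x y)) (cd_t z * r + cd_q x) (cd_t z * s + cd_q y)
     (cd_mul z z + cd_mul x y + (r * s) *: one)
     (cd_mul z x + b *: x + r *: cd_conj y)
     (cd_mul y z + b *: y + s *: cd_conj x).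
Proof.
have q1 : cd_dot one one = 1 := cd_q1 F k.
have i2 : ('i * 'i : F) = -1 by rewrite -expr2 sqrCi.
have cE := @cd_conjE F k.
have reM : cd_dot (cd_mul x y) one = cd_dot x (cd_conj y) by rewrite cd_dot_mulr cd_mul1r.
have mKV : cd_mul (cd_conj y) y = cd_q y *: one.
  by rewrite -{2}[y]cd_conjK cd_mul_conjr cd_q_conj.
rewrite jp_sqE !mkHE /kf; set ii := 'i in i2 *.
have diag12 : cd_q ((ii * (r - s / 4%:R)) *: one + (ii / 2%:R) *: (cd_conj z - z))
    = cd_dot z one ^+ 2 - cd_q z - (r - s / 4%:R) ^+ 2.
  rewrite cE /cd_q /cd_t !(cd_dotDl, cd_dotZl, cd_dotNl) !(cd_dotDr, cd_dotZr, cd_dotNr).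
  by rewrite q1 (cd_dotC one z); field: i2.
have rez : cd_dot (cd_mul z z + cd_mul x y + (r * s) *: one) one
    = cd_dot z one ^+ 2 *+ 2 - cd_q z + cd_dot x (cd_conj y) + r * s.
  by rewrite !cd_dotDl cd_dotZl reM cd_sqr cd_dotDl cd_dotNl !cd_dotZl q1 /cd_t; ring.
have q13 : cd_q (x + 2%:R^-1 *: cd_conj y) = cd_q x + cd_dot x (cd_conj y) + cd_q y / 4%:R.
  rewrite /cd_q !(cd_dotDl, cd_dotZl) !(cd_dotDr, cd_dotZr) -!/(cd_q _) cd_q_conj.
  by rewrite (cd_dotC (cd_conj y)); field.
have q23 : cd_q (ii *: x - (ii / 2%:R) *: cd_conj y)
    = - cd_q x + cd_dot x (cd_conj y) - cd_q y / 4%:R.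
  rewrite /cd_q !(cd_dotDl, cd_dotZl, cd_dotNl) !(cd_dotDr, cd_dotZr, cd_dotNr) -!/(cd_q _)
      cd_q_conj.
  by rewrite (cd_dotC (cd_conj y)); field: i2.
have tM : cd_t (cd_mul x y) = cd_dot x (cd_conj y) *+ 2 by exact: cd_tM.
apply: hermP; rewrite !mkHE.
- by rewrite [X in _ + X + _]diag12 [X in _ + X = _]q13 rez /cd_t; field.
- by rewrite [X in _ + X + _]diag12 [X in _ + X = _]q23 rez /cd_t; field.
- by rewrite [X in _ + X + _]q13 [X in _ + X = _]q23 tM; field.
- rewrite cd_sqr !(cd_conjD, cd_conjN, cd_conjZ) cd_conjK cd_conj1.
  rewrite !(cd_mulDl, cd_mulZl) !(cd_mulDr, cd_mulZr, cd_mulNr) cd_mul_conjr mKV -cd_conjM.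
  rewrite !(cE z) /cd_t.
  by apply/rowP => i; rewrite !mxE; field: i2.
- rewrite !cd_conjD !cd_conjZ cd_conjM cd_conjK !(cE z).
  rewrite !(cd_mulDl, cd_mulZl, cd_mulNl) !(cd_mulDr, cd_mulZr, cd_mulNr) !cd_mul1r /cd_t.
  by apply/rowP => i; rewrite !mxE; field: i2.
rewrite !(cd_conjD, cd_conjN, cd_conjZ) cd_conjM !cd_conjK cd_conj1 !(cE z).
rewrite !(cd_mulDl, cd_mulZl, cd_mulNl) !(cd_mulDr, cd_mulZr, cd_mulNr) !cd_mul1r /cd_t.
by apply/rowP => i; rewrite !mxE; field: i2.
Qed.

Definition kb (X : J) : F := hdiag 2 X.
Definition kz (X : J) : A :=
  (2%:R^-1 * (hdiag 0 X + hdiag 1 X)) *: one + ('i / 2%:R) *: (hoff 0 X - cd_conj (hoff 0 X)).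
Definition kr (X : J) : F :=
  4%:R^-1 * (hdiag 0 X - hdiag 1 X) - ('i / 2%:R) * cd_dot (hoff 0 X) one.
Definition ks (X : J) : F := hdiag 0 X - hdiag 1 X + ('i * 2%:R) * cd_dot (hoff 0 X) one.
Definition kx (X : J) : A := 2%:R^-1 *: (hoff 1 X - 'i *: hoff 2 X).
Definition ky (X : J) : A := cd_conj (hoff 1 X) + 'i *: cd_conj (hoff 2 X).

Lemma kfK (X : J) : kf (kb X) (kr X) (ks X) (kz X) (kx X) (ky X) = X.
Proof.
have q1 : cd_dot one one = 1 := cd_q1 F k.
have i2 : ('i * 'i : F) = -1 by rewrite -expr2 sqrCi.
rewrite /kf /kb /kr /ks /kz /kx /ky; set ii := 'i in i2 *.
have rez : cd_dot (hoff 0 X) one = cd_t (hoff 0 X) / 2%:R by rewrite /cd_t; field.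
apply: hermP; rewrite !mkHE //.
1,2: by rewrite !cd_dotDl !cd_dotZl !cd_dotDl cd_dotNl cd_dot_conjl cd_conj1 q1; field.
all: rewrite ?cd_conjD ?cd_conjZ ?cd_conjD ?cd_conjN ?cd_conjK ?cd_conj1 ?(cd_conjE (hoff 0 X))
    ?rez.
all: by apply/rowP => i; rewrite !mxE; field: i2.
Qed.

Lemma kf_comp b r s z x y :
  [/\ kb (kf b r s z x y) = b, kr (kf b r s z x y) = r, ks (kf b r s z x y) = s &
   [/\ kz (kf b r s z x y) = z, kx (kf b r s z x y) = x & ky (kf b r s z x y) = y]].
Proof.
have q1 : cd_dot one one = 1 := cd_q1 F k.
have i2 : ('i * 'i : F) = -1 by rewrite -expr2 sqrCi.
rewrite /kb /kr /ks /kz /kx /ky !mkHE; set ii := 'i in i2 *.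
have rez : cd_dot z one = cd_t z / 2%:R by rewrite /cd_t; field.
have re12 : cd_dot ((ii * (r - s / 4%:R)) *: one + (ii / 2%:R) *: (cd_conj z - z)) one
     = ii * (r - s / 4%:R).
  by rewrite cd_dotDl !cd_dotZl q1 cd_dotDl cd_dotNl cd_dot_conjl cd_conj1; ring.
split=> //; rewrite ?re12; try by field: i2.
split.
- rewrite !(cd_conjD, cd_conjZ) cd_conjN cd_conjK cd_conj1 cd_conjE rez.
  by apply/rowP => i; rewrite !mxE; field: i2.
- by apply/rowP => i; rewrite !mxE; field: i2.
rewrite !(cd_conjD, cd_conjZ) cd_conjN !cd_conjZ cd_conjK.
by apply/rowP => i; rewrite !mxE; field: i2.
Qed.

Lemma kr_kf b r s z x y : kr (kf b r s z x y) = r.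
Proof. by have [] := kf_comp b r s z x y. Qed.

Lemma kx_kf b r s z x y : kx (kf b r s z x y) = x.
Proof. by have [_ _ _ []] := kf_comp b r s z x y. Qed.

End IsotropicCoordinates.

(** * The affine chart *)

Section Chart.
Variable F : numClosedFieldType.
Variable k : nat.
Hypothesis hk : (k <= 3)%N.
Local Notation A := (cd_alg F k).
Local Notation J := (herm3 F k).
Local Notation one := (cd_one F k).

Section Graph.
Variables (w x1 x2 : A) (lam c : F).

(* [gu2] is a traceless matrix whose entry [r] vanishes. If [cd_q x2] is invertible, then
   [gu1] is the element with [r = 1] of the span of [1], [gu2] and its square;
   the entries of [gu2] are parametrized in such a way that the factor [cd_q x2]
   cancels in [gu1], see [gu2_sq]. *)
Definition gkappa : F := 3%:R * lam + cd_dot x2 x1 *+ 2.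
Definition gz1 : A := w - ((cd_t w + cd_q x1) / 3%:R) *: one.
Definition gz2 : A := - (lam *: one + cd_mul x2 (cd_conj x1)).

Definition gu1 : J :=
  kf (- cd_t gz1) 1 (cd_q w - gkappa * c) gz1 x1
     (c *: cd_conj x2 + cd_mul (cd_conj x1) w).

Definition gu2 : J :=
  kf (2%:R * lam + cd_dot x2 x1 *+ 2) 0
     (cd_q x2 * c + cd_dot (cd_mul w x2) x1 *+ 2 + gkappa * cd_q x1)
     gz2 x2 (- (cd_conj (cd_mul w x2) + gkappa *: cd_conj x1)).

Definition gmu : F :=
  lam * gkappa - cd_q gz2 - cd_q x2 * (2%:R * cd_t gz1 + cd_q x1).

Let q1 : cd_dot one one = 1. Proof. exact: cd_q1. Qed.

Lemma cd_t_gz1 : cd_t gz1 = (cd_t w - 2%:R * cd_q x1) / 3%:R.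
Proof. by rewrite /gz1 /cd_t cd_dotDl cd_dotNl cd_dotZl q1; field. Qed.

Lemma cd_t_gz2 : cd_t gz2 = - (2%:R * lam + cd_dot x2 x1 *+ 2).
Proof.
rewrite /gz2 /cd_t cd_dotNl cd_dotDl cd_dotZl q1.
by rewrite cd_dot_mulr cd_conjK cd_mul1r; ring.
Qed.

Lemma gu1_tr : herm_tr gu1 = 0.
Proof. by rewrite kf_tr addNr. Qed.

Lemma gu2_tr : herm_tr gu2 = 0.
Proof. by rewrite kf_tr cd_t_gz2 subrr. Qed.

Let swap : cd_mul x2 (cd_conj x1) = (cd_dot x2 x1 *+ 2) *: one - cd_mul x1 (cd_conj x2).
Proof. by rewrite -cd_mulC_dot addrK. Qed.

Lemma gu2_sq :
  jp gu2 gu2 = cd_q x2 *: gu1 + (lam *: gu2 + gmu *: herm_id F k).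
Proof.
have cE := @cd_conjE F k.
have qz2 : cd_q gz2 = lam ^+ 2 + (lam * cd_dot x2 x1) *+ 2 + cd_q x2 * cd_q x1.
  rewrite /gz2 /cd_q cd_dotNl cd_dotNr opprK !cd_dotDl !cd_dotDr !cd_dotZl !cd_dotZr q1.
  rewrite -!/(cd_q _) cd_qM // cd_q_conj (cd_dotC one) cd_dot_mulr cd_conjK cd_mul1r.
  by ring.
have dy : cd_dot x2 (cd_mul w x2) = cd_q x2 * cd_dot w one.
  by rewrite -{1}(cd_mul1r x2) cd_dotMr // cd_dotC.
rewrite kf_id /gu1 /gu2 kf_sq // !kfZ !kfD; congr kf.
- rewrite /gmu qz2 cd_tM cd_conjN cd_conjD cd_conjZ !cd_conjK cd_dotNr cd_dotDr cd_dotZr dy.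
  by rewrite cd_t_gz1 /cd_t /gkappa; field.
- by rewrite !mulr0 !addr0 add0r mulr1.
- rewrite cd_t_gz2 /cd_q cd_dotNl cd_dotNr opprK !cd_dotDl !cd_dotDr !cd_dotZl !cd_dotZr.
  rewrite !cd_dot_conj -!/(cd_q _) cd_qM // (cd_dotC x1 (cd_mul _ _)) /gkappa; ring.
- have e : cd_mul x2 (cd_conj (cd_mul w x2)) = cd_q x2 *: cd_conj w.
    by rewrite cd_conjM cd_mulKV.
  rewrite cd_sqr cd_t_gz2 mul0r scale0r addr0 cd_mulNr cd_mulDr cd_mulZr e (cE w).
  rewrite /gmu cd_t_gz1; set qz := cd_q gz2; rewrite /gz2 /gz1 /gkappa.
  by apply/rowP => i; rewrite !mxE; field.
- have e : cd_mul (cd_mul x2 (cd_conj x1)) x2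
      = (cd_dot x2 x1 *+ 2) *: x2 - cd_q x2 *: x1.
    by rewrite swap cd_mulDl cd_mulNl cd_mulZl cd_mul1r cd_mulrVK.
  rewrite /gz2 cd_mulNl cd_mulDl cd_mulZl cd_mul1r e.
  by apply/rowP => i; rewrite !mxE; ring.
have d : cd_dot (cd_conj x2) (cd_mul (cd_conj x1) w) = cd_dot (cd_mul w x2) x1.
  by rewrite cd_dotC cd_dot_mull cd_conjK [RHS]cd_dot_mulr.
have e : cd_mul (cd_conj (cd_mul w x2)) (cd_mul x1 (cd_conj x2))
    = (cd_dot (cd_mul w x2) x1 *+ 2) *: cd_conj x2 - cd_q x2 *: cd_mul (cd_conj x1) w.
  by rewrite cd_conjM cd_moufang // cd_conjM cd_conjK cd_q_conj d.
have e1 : cd_mul (cd_conj x1) (cd_mul x1 (cd_conj x2)) = cd_q x1 *: cd_conj x2.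
  by rewrite cd_mulVK.
rewrite /gz2 swap; set v := cd_conj (cd_mul w x2) in e *.
rewrite cd_mulNl !cd_mulNr !cd_mulDr !cd_mulNr !cd_mulZr !cd_mulr1.
rewrite !cd_mulDl !cd_mulZl e e1 /gkappa.
by apply/rowP => i; rewrite !mxE; ring.
Qed.

End Graph.

Variable i0 : 'I_(cd_dim k).
Hypothesis one_i0 : one 0 i0 = 1.

Lemma gu2_solve (X : J) :
  herm_tr X = 0 -> kr X = 0 -> (kx X : A) 0 i0 = 1 -> cd_q (kx X) != 0 ->
  exists (w x1 : A) (lam c : F), x1 0 i0 = 0 /\ X = gu2 w x1 (kx X) lam c.
Proof.
have eX := kfK X; move=> trX r0 x0 Q0; rewrite r0 in eX; rewrite -eX kf_tr in trX.
suff: exists (w x1 : A) (lam c : F), x1 0 i0 = 0 /\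
    kf (kb X) 0 (ks X) (kz X) (kx X) (ky X) = gu2 w x1 (kx X) lam c by rewrite eX.
move: (kb X) (ks X) (kz X) (kx X) (ky X) trX x0 Q0 {eX}.
move=> b s z x y trX x0 Q0.
set zx := cd_mul (cd_conj z) x.
pose lam := - zx 0 i0; pose x1 := - (cd_q x)^-1 *: (lam *: x + zx).
pose ka := gkappa x1 x lam.
pose w := - (cd_q x)^-1 *: cd_mul (cd_conj y + ka *: x1) (cd_conj x).
pose c := (s - cd_dot (cd_mul w x) x1 *+ 2 - ka * cd_q x1) / cd_q x.
exists w, x1, lam, c; split; first by rewrite !mxE x0 /lam; ring.
have e1 : cd_mul x (cd_conj x1) = - (lam *: one + z).
  rewrite /x1 cd_conjZ cd_conjD cd_conjZ cd_conjM cd_conjK cd_mulZr cd_mulDr cd_mulZr.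
  rewrite cd_mul_conjr cd_mulKV // scalerA mulrC -scalerA -scalerDr scalerA.
  by rewrite mulNr mulVf // scaleN1r.
have e2 : cd_mul w x = - (cd_conj y + ka *: x1).
  by rewrite /w cd_mulZl cd_mulrVK // scalerA mulNr mulVf // scaleN1r.
have ez : z = gz2 x1 x lam by rewrite /gz2 e1; apply/rowP => i; rewrite !mxE; ring.
rewrite /gu2; congr kf => //.
- by have := cd_t_gz2 x1 x lam; rewrite -ez => e; move/eqP: trX; rewrite addr_eq0 e opprK => /eqP.
- by rewrite /c -/ka; field.
- by rewrite e2 cd_conjN cd_conjD cd_conjZ cd_conjK -/ka; apply/rowP => i; rewrite !mxE; ring.
Qed.

(* Coordinates on the chart: the last two rows of the matrix [v] store [x1] and
   [x2], except that their entries at [i0], which are [0] and [1], are replaced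
   by [lam] and [c]. *)
Local Notation V := 'rV[F]_(3 * cd_dim k).
Definition pw (v : V) : A := row (inord 0) (vec_mx v).
Definition plam (v : V) : F := vec_mx v (inord 1) i0.
Definition pc (v : V) : F := vec_mx v (inord 2) i0.
Definition px1 (v : V) : A := row (inord 1) (vec_mx v) - plam v *: delta_mx 0 i0.
Definition px2 (v : V) : A := row (inord 2) (vec_mx v) + (1 - pc v) *: delta_mx 0 i0.
Definition pmake (w x1 x2 : A) (lam c : F) : V :=
  mxvec (\matrix_(i, j) ([:: w; x1 + lam *: delta_mx 0 i0; x2 + (c - 1) *: delta_mx 0 i0]`_i : A)
      0 j).

Lemma px1_i0 v : px1 v 0 i0 = 0.
Proof. by rewrite !mxE !eqxx /plam !mxE /=; ring. Qed.

Lemma px2_i0 v : px2 v 0 i0 = 1.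
Proof. by rewrite !mxE !eqxx /pc !mxE /=; ring. Qed.

Lemma pmakeK (w x1 x2 : A) (lam c : F) : x1 0 i0 = 0 -> x2 0 i0 = 1 ->
  let v := pmake w x1 x2 lam c in
  [/\ pw v = w, px1 v = x1, px2 v = x2, plam v = lam & pc v = c].
Proof.
move=> h1 h2 v.
have el : plam v = lam by rewrite /plam mxvecK !mxE inordK //= !mxE h1 !eqxx /=; ring.
have ec : pc v = c by rewrite /pc mxvecK !mxE inordK //= !mxE h2 !eqxx /=; ring.
split=> //; rewrite /px1 /px2 ?el ?ec /pw mxvecK; apply/rowP => i; rewrite !mxE inordK //= !mxE
    //; ring.
Qed.

Lemma pK v : pmake (pw v) (px1 v) (px2 v) (plam v) (pc v) = v.
Proof.
rewrite /pmake -[RHS]vec_mxK; congr mxvec; apply/matrixP => i j; rewrite mxE; move: i.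
apply: ord3P; rewrite inordK //= /px1 /px2 ?mxE //; ring.
Qed.

Definition cell_gen1 v := gu1 (pw v) (px1 v) (px2 v) (plam v) (pc v).
Definition cell_gen2 v := gu2 (pw v) (px1 v) (px2 v) (plam v) (pc v).

Definition pcoord (X Y : J) : V :=
  let w := kz X + (cd_t (kz X) + cd_q (kx X)) *: one in
  pmake w (kx X) (kx Y) (2%:R^-1 * kb Y - cd_dot (kx Y) (kx X))
    ((cd_conj (ky X) - cd_mul (cd_conj w) (kx X)) 0 i0).

Lemma pcoordK v : pcoord (cell_gen1 v) (cell_gen2 v) = v.
Proof.
rewrite /pcoord /cell_gen1 /cell_gen2 /gu1 /gu2.
set w := pw v; set x1 := px1 v; set x2 := px2 v; set lam := plam v; set c := pc v.
set e := gkappa _ _ _; set f := _ + _ *: cd_conj x1; set s1 := _ - _ * _; set s2 := _ + _ * cd_q x1.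
have [_ _ _ [-> -> ->]] := kf_comp (- cd_t (gz1 w x1)) 1 s1 (gz1 w x1) x1 (c *: cd_conj x2 +
    cd_mul (cd_conj x1) w).
set b2 := _ + _ *+ 2.
have [-> _ _ [_ -> _]] := kf_comp b2 0 s2 (gz2 x1 x2 lam) x2 (- f).
have -> : gz1 w x1 + (cd_t (gz1 w x1) + cd_q x1) *: one = w.
  by rewrite cd_t_gz1; apply/rowP => i; rewrite !mxE; field.
rewrite cd_conjD cd_conjZ cd_conjK cd_conjM cd_conjK addrK mxE px2_i0 mulr1.
have -> : 2%:R^-1 * b2 - cd_dot x2 x1 = lam by rewrite /b2; field.
exact: pK.
Qed.

End Chart.

(** * Reductions and their generators *)

Section Reductions.
Variable F : numClosedFieldType.
Variable k : nat.
Hypothesis hk : (k <= 3)%N.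
Local Notation A := (cd_alg F k).
Local Notation J := (herm3 F k).
Local Notation Id := (herm_id F k).
Implicit Types X Y Z : J.

Lemma herm_projE X : herm_proj X = X - (3%:R^-1 * herm_tr X) *: Id.
Proof. by []. Qed.

Lemma herm_projD X Y : herm_proj (X + Y) = herm_proj X + herm_proj Y.
Proof. exact: linearD. Qed.
Lemma herm_projZ c X : herm_proj (c *: X) = c *: herm_proj X.
Proof. exact: linearZ. Qed.

Lemma herm_proj_sum (I : finType) (f : I -> J) : herm_proj (\sum_i f i) = \sum_i herm_proj (f i).
Proof. exact: linear_sum. Qed.

Lemma herm_proj_id : herm_proj Id = 0.
Proof. by rewrite herm_projE herm_tr_id mulVf ?pnatr_eq0 // scale1r subrr. Qed.

Lemma herm_proj_traceless X : herm_tr X = 0 -> herm_proj X = X.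
Proof. by move=> e; rewrite herm_projE e mulr0 scale0r subr0. Qed.

Lemma herm_tr_proj X : herm_tr (herm_proj X) = 0.
Proof. by rewrite herm_projE -scaleN1r scalerA herm_trD herm_trZ herm_tr_id; field. Qed.

Lemma mem_traceless X : (X \in herm_traceless F k) = (herm_tr X == 0).
Proof. by rewrite memv_ker lfunE. Qed.

Definition lc3 (V : lmodType F) (u v w : V) (a b c : F) : V := a *: u + b *: v + c *: w.

Lemma lc3D V u v w a b c a' b' c' :
  @lc3 V u v w a b c + lc3 u v w a' b' c' = lc3 u v w (a + a') (b + b') (c + c').
Proof. by rewrite /lc3 !scalerDl addrACA; congr (_ + _); rewrite addrACA. Qed.

Lemma lc3Z V u v w d a b c : d *: @lc3 V u v w a b c = lc3 u v w (d * a) (d * b) (d * c).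
Proof. by rewrite /lc3 !scalerDr !scalerA. Qed.

Lemma lc3N V u v w a b c : - @lc3 V u v w a b c = lc3 u v w (- a) (- b) (- c).
Proof. by rewrite -scaleN1r lc3Z !mulN1r. Qed.

Lemma lc3_basis V u v w :
  [/\ u = @lc3 V u v w 1 0 0, v = lc3 u v w 0 1 0 & w = lc3 u v w 0 0 1].
Proof. by rewrite /lc3 !scale1r !scale0r !addr0 !add0r. Qed.

Definition el X : F -> F -> F -> J := lc3 Id X (jp X X).

Lemma el_mul X p0 p1 p2 q0 q1 q2 : herm_tr X = 0 ->
  jp (el X p0 p1 p2) (el X q0 q1 q2) =
  el X (p0 * q0 + (p1 * q2 + p2 * q1) * herm_det X)
       (p0 * q1 + p1 * q0 - (p1 * q2 + p2 * q1) * herm_s X + p2 * q2 * herm_det X)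
       (p0 * q2 + p1 * q1 + p2 * q0 - p2 * q2 * herm_s X).
Proof.
move=> trX; have ch := cayley_hamilton hk X; have pa := jp_power_assoc hk X.
rewrite trX scale0r add0r in ch; rewrite trX expr0n !mul0r scale0r !addr0 subr0 sub0r in pa.
rewrite /el {1 2}/lc3 !jpE !(jpC _ Id) !jp_id (jpC (jp X X) X) ch pa.
move: Id X (jp X X) (herm_s X) (herm_det X) {trX ch pa} => I Y Y2 s d.
have [eI eY eY2] := lc3_basis I Y Y2.
have eD := lc3D I Y Y2; have eZ := lc3Z I Y Y2; have eN := lc3N I Y Y2.
move: (lc3 I Y Y2) eI eY eY2 eD eZ eN => e eI eY eY2 eD eZ eN.
by rewrite eI eY eY2 !(eZ, eN, eD); congr (e _ _ _); ring.
Qed.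

Lemma el_tr X p0 p1 p2 : herm_tr X = 0 -> herm_tr (el X p0 p1 p2) = 3%:R * p0 - 2%:R * herm_s X *
    p2.
Proof.
move=> trX; have tr2 : herm_tr (jp X X) = - (2%:R * herm_s X).
  have e : herm_tr X ^+ 2 = 0 by rewrite trX expr0n.
  by rewrite -[RHS]add0r -e !herm_trE jp_sqE !mkHE /herm_s; ring.
by rewrite /el /lc3 !herm_trD !herm_trZ tr2 trX herm_tr_id; ring.
Qed.

Definition lineX X : {vspace J} := (<[X]> + <[herm_proj (jp X X)]>)%VS.

Lemma lineX_el X Y : herm_tr X = 0 -> Y \in lineX X -> exists p0 p1 p2, Y = el X p0 p1 p2.
Proof.
move=> trX /memv_addP[_ /vlineP[a ->] [_ /vlineP[b ->] ->]].
exists (- b * (3%:R^-1 * herm_tr (jp X X))), a, b; rewrite herm_projE /el.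
by rewrite /lc3 scalerBr scalerA mulNr scaleNr -[in RHS]addrA [in RHS]addrC addrA.
Qed.

Lemma el_lineX X p0 p1 p2 : herm_tr X = 0 -> herm_proj (el X p0 p1 p2) \in lineX X.
Proof.
move=> trX; rewrite /el /lc3 !herm_projD !herm_projZ herm_proj_id scaler0 add0r
    herm_proj_traceless //.
by rewrite memv_add // memvZ // memv_line.
Qed.

Lemma lineX_closed X Y : herm_tr X = 0 -> Y \in lineX X -> herm_proj (jp Y Y) \in lineX X.
Proof.
by move=> trX /(lineX_el trX)[p0 [p1 [p2 ->]]]; rewrite el_mul //; apply: el_lineX.
Qed.

Lemma lineX_traceless X : herm_tr X = 0 -> (lineX X <= herm_traceless F k)%VS.
Proof.
move=> trX; rewrite subv_add; apply/andP.
by split; rewrite -memvE mem_traceless ?trX ?herm_tr_proj.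
Qed.

End Reductions.

Section Bilinear.
Variables (F : fieldType) (V : vectType F).

Lemma lin_coord_sum (x : V) : x = \sum_i lin_coord x i *: (vbasis {:V})`_i.
Proof. exact: coord_vbasis (memvf x). Qed.

Lemma meval_mderivXU n (v : 'I_n -> F) (i l : 'I_n) : (('X_i)^`M(l)).@[v] = (i == l)%:R :> F.
Proof.
rewrite mderivX mevalZ mnm1E; have [->|_] := eqVneq i l; last by rewrite mul0r.
have -> : (U_(l) - U_(l) = 0 :> 'X_{1..n})%MM by apply/mnmP => j; rewrite mnmBE mnm0E subnn.
by rewrite mpolyX0 meval1 mulr1.
Qed.

Lemma dim_line_add (U : {vspace V}) (x : V) :
  x \notin U -> \dim (U + <[x]>)%VS = (\dim U).+1.
Proof.
move=> xU; rewrite dimv_disjoint_sum ?dim_vline.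
  by case: eqVneq xU => [->|_ _]; rewrite ?mem0v ?addn1.
apply/eqP; rewrite -subv0; apply/subvP => y; rewrite memv_cap => /andP[yU /vlineP[a ya]].
rewrite ya in yU *; have [->|a0] := eqVneq a 0; first by rewrite scale0r mem0v.
by case/negP: xU; rewrite -(scale1r x) -(mulVf a0) -scalerA memvZ.
Qed.

Variables (W : lmodType F) (B : V -> V -> W).
Hypothesis BP : (forall z, linear (B ^~ z)) * (forall z, linear (B z)).

Lemma bilinear_sum (x z : V) :
  B x z = \sum_(i < \dim {:V}) \sum_(j < \dim {:V}) (lin_coord x i * lin_coord z j) *: B (vbasis
      {:V})`_i (vbasis {:V})`_j.
Proof.
have BDl u a b : B (a + b) u = B a u + B b u by have := BP.1 u 1 a b; rewrite !scale1r.
have BDr u a b : B u (a + b) = B u a + B u b by have := BP.2 u 1 a b; rewrite !scale1r.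
have B0l u : B 0 u = 0 by apply: (addrI (B 0 u)); rewrite -BDl !addr0.
have B0r u : B u 0 = 0 by apply: (addrI (B u 0)); rewrite -BDr !addr0.
have BZl u c a : B (c *: a) u = c *: B a u by have := BP.1 u c a 0; rewrite !addr0 B0l addr0.
have BZr u c a : B u (c *: a) = c *: B u a by have := BP.2 u c a 0; rewrite !addr0 B0r addr0.
rewrite {1}(lin_coord_sum x) (big_morph (B ^~ z) (BDl z) (B0l z)); apply: eq_bigr => i _.
rewrite BZl {1}(lin_coord_sum z) (big_morph _ (BDr _) (B0r _)) scaler_sumr.
by apply: eq_bigr => j _; rewrite BZr scalerA.
Qed.

End Bilinear.

Section TangentQuadric.
Variables (F : fieldType) (V : vectType F) (B : V -> V -> F^o).
Hypothesis BP : (forall z, linear (B ^~ z)) * (forall z, linear (B z)).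

Lemma tangent_quadric (S : V -> Prop) (x z : V) :
  (forall y, S y -> B y y = 0) -> tangent_at S x z -> B x z + B z x = 0.
Proof.
move=> SB tg; pose b := (vbasis {:V}).
pose p : {mpoly F[\dim {:V}]} 
  := \sum_(i < \dim {:V}) \sum_(j < \dim {:V}) (B b`_i b`_j : F) *: ('X_i * 'X_j).
have pE y : p.@[lin_coord y] = B y y.
  rewrite (bilinear_sum BP) /p raddf_sum; apply: eq_bigr => i _; rewrite raddf_sum /=.
  by apply: eq_bigr => j _; rewrite mevalZ mevalM !mevalXU mulrC.
have := tg p; rewrite /p => /(_ _)<-; last by move=> y /SB; rewrite -pE.
have -> : \sum_l (p^`M(l)).@[lin_coord x] * lin_coord z l =
   \sum_(i < \dim {:V}) \sum_(j < \dim {:V}) \sum_l ((B b`_i b`_j : F) * ((i == l)%:R * lin_coord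
       x j + lin_coord x i * (j == l)%:R)) * lin_coord z l.
  under [RHS]eq_bigr => i _ do rewrite exchange_big /=.
  rewrite [RHS]exchange_big /=; apply: eq_bigr => l _.
  rewrite /p (linear_sum (mderiv l)) (raddf_sum (meval (lin_coord x))) mulr_suml /=; apply:
      eq_bigr => i _.
  rewrite (linear_sum (mderiv l)) (raddf_sum (meval (lin_coord x))) mulr_suml /=; apply: eq_bigr
      => j _.
  by rewrite mderivZ mevalZ mderivM mevalD !mevalM !meval_mderivXU !mevalXU.
rewrite (bilinear_sum BP x) (bilinear_sum BP z) -big_split /=; apply: eq_bigr => i _.
rewrite -big_split /=; apply: eq_bigr => j _.
have sumd (m : 'I_(\dim {:V})) : \sum_l (m == l)%:R * lin_coord z l = lin_coord z m.
  rewrite (bigD1 m) //= eqxx mul1r big1 ?addr0 // => l; rewrite eq_sym => /negPf->.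
  by rewrite mul0r.
rewrite -(sumd i) -{1}(sumd j) /GRing.scale /= mulr_sumr !mulr_suml -big_split /=.
by apply: eq_bigr => l _; ring.
Qed.

End TangentQuadric.

Section Frames.
Variable F : numClosedFieldType.
Variable k : nat.
Hypothesis hk : (k <= 3)%N.
Local Notation J := (herm3 F k).
Local Notation Id := (herm_id F k).
Implicit Types X Y Z : J.

Lemma tangent_severi X Z : tangent_at (@severi_cone F k) X Z ->
  2%:R *: jp X Z = herm_tr X *: Z + herm_tr Z *: X.
Proof.
move=> tg; pose G Y Y' : J := jp Y Y' - herm_tr Y *: Y'.
have GP : (forall Z', linear (G ^~ Z')) * (forall Z', linear (G Z')).
  split=> Y c Y1 Y2; rewrite /G.
    by rewrite jpDl jpZl herm_trD herm_trZ scalerDl scalerBr scalerA opprD addrACA.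
  by rewrite jpDr jpZr scalerDr opprD scalerBr !scalerA (mulrC c) addrACA.
suff e : G X Z + G Z X = 0.
  move: e; rewrite /G (jpC Z) addrACA -opprD => /eqP; rewrite subr_eq0 => /eqP <-.
  by rewrite scaler_nat.
rewrite (lin_coord_sum (G X Z + G Z X)) big1 // => i _.
pose B Y Y' : F^o := lin_coord (G Y Y') i.
have BP : (forall Z', linear (B ^~ Z')) * (forall Z', linear (B Z')).
  by split=> Y c Y1 Y2; rewrite /B ?(GP.1 Y) ?(GP.2 Y) /lin_coord linearP.
have -> : lin_coord (G X Z + G Z X) i = 0; last by rewrite scale0r.
rewrite /lin_coord linearD; apply: (tangent_quadric BP _ tg) => Y /severi_coneE e.
by rewrite /B /G e subrr /lin_coord linear0.
Qed.

Section Frame.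
Variable e : 'I_3 -> J.
Hypothesis eM : forall i j, jp (e i) (e j) = (i == j)%:R *: e i.
Hypothesis e_tr : forall i, herm_tr (e i) = 1.
Hypothesis e_sum : \sum_i e i = Id.

Let T := [tuple e i | i < 3].
Definition frame_space : {vspace J} := <<T>>%VS.

Let TE (i : 'I_3) : T`_i = e i. Proof. by rewrite -tnth_nth tnth_mktuple. Qed.

Lemma frame_mul_sum (c : 'I_3 -> F) i : jp (e i) (\sum_j c j *: e j) = c i *: e i.
Proof.
rewrite jp_sumr (bigD1 i) //= jpZr eM eqxx scale1r big1 ?addr0 // => j ne.
by rewrite jpZr eM eq_sym (negPf ne) scale0r scaler0.
Qed.

Lemma frame_neq0 i : e i != 0.
Proof. by apply/eqP => e0; have := e_tr i; rewrite e0 linear0 => /eqP; rewrite eq_sym oner_eq0. Qed.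

Lemma frame_sum_inj (c c' : 'I_3 -> F) :
  \sum_j c j *: e j = \sum_j c' j *: e j -> c =1 c'.
Proof.
move=> h i; have := congr1 (jp (e i)) h; rewrite !frame_mul_sum => /eqP.
by rewrite -subr_eq0 -scalerBl scaler_eq0 (negPf (frame_neq0 i)) orbF subr_eq0 => /eqP.
Qed.

Lemma frame_dim : \dim frame_space = 3%N.
Proof.
have : free T.
  apply/freeP => c h i; apply: (@frame_sum_inj c (fun=> 0)).
  under eq_bigr => j _ do rewrite -TE.
  by rewrite h big1 // => j _; rewrite scale0r.
by rewrite /free size_tuple => /eqP.
Qed.

Lemma mem_frame i : e i \in frame_space.
Proof. by rewrite -TE memv_span // mem_nth // size_tuple. Qed.

Lemma frame_id : Id \in frame_space.
Proof. by rewrite -e_sum memv_suml // => i _; apply: mem_frame. Qed.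

Lemma frameP Y : Y \in frame_space -> exists c : 'I_3 -> F, Y = \sum_i c i *: e i.
Proof.
move=> /coord_span ->; exists (fun i => coord T i Y).
by apply: eq_bigr => i _; rewrite TE.
Qed.

Lemma frame_sqr (c : 'I_3 -> F) :
  jp (\sum_i c i *: e i) (\sum_i c i *: e i) = \sum_i (c i ^+ 2) *: e i.
Proof.
rewrite jp_sumr; apply: eq_bigr => i _.
by rewrite jpZr jpC frame_mul_sum scalerA expr2.
Qed.

Lemma frame_tr (c : 'I_3 -> F) : herm_tr (\sum_i c i *: e i) = \sum_i c i.
Proof. by rewrite linear_sum; apply: eq_bigr => i _; rewrite linearZ /= e_tr /GRing.scale /=
    mulr1. Qed.

Lemma frame_cone (c : 'I_3 -> F) :
  severi_cone (\sum_i c i *: e i) -> exists i, forall j, j != i -> c j = 0.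
Proof.
move/severi_coneE; rewrite frame_sqr frame_tr scaler_sumr => h.
set s := \sum_i c i in h.
have cs i : c i ^+ 2 = s * c i.
  apply: (@frame_sum_inj (fun i => c i ^+ 2) (fun i => s * c i)); rewrite h.
  by apply: eq_bigr => j _; rewrite scalerA.
have [[i ci]|] := pselect (exists i, c i != 0); last first.
  move=> h0; exists ord0 => j _; apply/eqP/contraT => cj; case: h0; by exists j.
exists i; have cE j : c j = (c j != 0)%:R * s.
  have [->|cj] := eqVneq (c j) 0; first by rewrite mul0r.
  by rewrite mul1r; apply: (mulIf cj); rewrite -expr2 cs.
have s0 : s != 0 by apply: contra_neq ci => s0; rewrite cE s0 mulr0.
have : s = (\sum_j (c j != 0)%:R) * s.
  by rewrite mulr_suml; apply: eq_bigr => j _; rewrite -cE.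
rewrite -[X in X = _]mul1r => /(mulIf s0)/eqP; rewrite -natr_sum (eqr_nat F 1%N).
rewrite (bigD1 i) //= ci eq_sym -[X in _ == X]/(1 + 0)%N eqn_add2l sum_nat_eq0 => /forall_inP h0
    j ne.
by have := h0 j ne; rewrite eqb0 negbK => /eqP.
Qed.

Lemma frame_simply_3secant : simply_3secant (@severi_cone F k) frame_space.
Proof.
have memL i : (<[e i]> <= frame_space)%VS by rewrite -memvE mem_frame.
split; first exact: frame_dim.
have delta (a : F) i : \sum_j (if j == i then a else 0) *: e j = a *: e i.
  rewrite (bigD1 i) //= eqxx big1 ?addr0 // => j /negPf->; exact: scale0r.
exists [seq <[e i]>%VS | i <- enum 'I_3]; split.
- rewrite map_inj_uniq ?enum_uniq // => i j h.
  have : e i \in <[e j]>%VS by rewrite -h memv_line.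
  move=> /vlineP[a ea]; have := congr1 (jp (e i)) ea.
  rewrite jpZr !eM eqxx scale1r; case: eqVneq => // _.
  by rewrite scale0r scaler0 => /eqP; rewrite (negPf (frame_neq0 i)).
- by rewrite size_map size_enum_ord.
- move=> L; split=> [/mapP[i _ ->]|[[dL cL] sL]].
    split=> //; split=> [|x /vlineP[a ->]]; first by rewrite dim_vline frame_neq0.
    apply/severi_coneE; rewrite -delta frame_sqr frame_tr scaler_sumr.
    apply: eq_bigr => j _; rewrite scalerA; congr (_ *: _).
    have -> : \sum_j (if j == i then a else 0) = a.
      by rewrite (bigD1 i) //= eqxx big1 ?addr0 // => l /negPf->.
    by case: eqP; rewrite ?expr2 ?mulr0.
  have [x xL x0] : exists2 x, x \in L & x != 0.
    exists (vpick L); first exact: memv_pick.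
    by rewrite vpick0 -dimv_eq0 dL.
  have LE : L = <[x]>%VS.
    by apply/eqP; rewrite eq_sym eqEdim -memvE xL dL dim_vline x0.
  have [c xE] := frameP (subvP sL _ xL).
  have /frame_cone[i ci] : severi_cone (\sum_i c i *: e i) by rewrite -xE; apply: cL.
  apply/mapP; exists i; rewrite ?mem_enum //.
  have xi : x = c i *: e i.
    by rewrite xE (bigD1 i) //= big1 ?addr0 // => j /ci->; rewrite scale0r.
  apply/eqP; rewrite LE eqEdim !dim_vline x0 frame_neq0 -memvE xi memvZ ?memv_line //.
move=> _ /mapP[i _ ->] x z /vlineP[a ->] ax zP /tangent_severi.
have [c ->] := frameP zP.
have a0 : a != 0 by apply: contraNneq ax => ->; rewrite scale0r.
rewrite jpZl frame_mul_sum frame_tr herm_trZ e_tr mulr1 scaler_sumr => h.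
have {h} : \sum_j (if j == i then 2%:R * (a * c i) - (\sum_j c j) * a else 0) *: e j
    = \sum_j (a * c j) *: e j.
  rewrite delta scalerBl -!scalerA h addrK.
  by apply: eq_bigr => j _; rewrite scalerA.
move=> /frame_sum_inj h; rewrite (bigD1 i) //= big1 ?addr0 ?memvZ ?memv_line // => j ne.
have := h j; rewrite (negPf ne) => /esym/eqP; rewrite mulf_eq0 (negPf a0) => /eqP ->.
exact: scale0r.
Qed.

End Frame.

End Frames.

Section Generators.
Variable F : numClosedFieldType.
Variable k : nat.
Hypothesis hk : (k <= 3)%N.
Local Notation J := (herm3 F k).
Local Notation Id := (herm_id F k).
Implicit Types X Y Z : J.

Lemma cubic_roots (s d : F) : exists l1 l2 l3 : F,
  [/\ l1 + l2 + l3 = 0, l1 * l2 + l1 * l3 + l2 * l3 = s & l1 * l2 * l3 = d].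
Proof.
pose q : {poly F} := s *: 'X - d%:P; pose p := 'X^3 + q.
have qs : (size q < size ('X^3 : {poly F}))%N.
  rewrite size_polyXn; apply: (@leq_ltn_trans 2) => //.
  apply: (leq_trans (size_polyD _ _)); rewrite size_polyN geq_max size_polyC.
  by rewrite (leq_trans (size_scale_leq _ _)) ?size_polyX //; case: (d != 0).
have ps : size p = 4%N by rewrite size_polyDl // size_polyXn.
have [r pE] := closed_field_poly_normal p.
rewrite lead_coefDl // lead_coefXn scale1r in pE.
have : size r = 3%N by move: ps; rewrite pE size_prod_XsubC => -[].
case: r pE => [|l1 [|l2 [|l3 [|]]]] // pE _; exists l1, l2, l3.
have ev t : t ^+ 3 + (s * t - d) = (t - l1) * (t - l2) * (t - l3).
  have := congr1 (fun u => u.[t]) pE; rewrite /p /q !big_cons big_nil mulr1 mulrA.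
  by rewrite !hornerE.
have z t := etrans (congr1 (fun u => u - _) (ev t)) (subrr _).
have two : (2%:R : F) != 0 by rewrite pnatr_eq0.
have h3 : l1 * l2 * l3 - d = 0 by rewrite -[RHS](z 0); ring.
have h1 : 2%:R * (l1 + l2 + l3) = 0.
  rewrite -[RHS](addr0 0) -{1}(z 1) -(z (-1)) -[RHS]subr0 -(mulr0 2%:R) -h3; ring.
have h2 : 2%:R * (l1 * l2 + l1 * l3 + l2 * l3 - s) = 0.
  rewrite -[RHS](subr0 0) -{1}(z (-1)) -(z 1); ring.
split; apply/eqP; last by rewrite -subr_eq0 h3.
  by move/eqP: h1; rewrite mulf_eq0 (negPf two).
by move/eqP: h2; rewrite mulf_eq0 (negPf two) subr_eq0.
Qed.

Lemma dim_proj (P : {vspace J}) : \dim P = 3%N -> (2 <= \dim (linfun (@herm_proj F k) @: P))%N.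
Proof.
move=> dP; have := limg_ker_dim (linfun (@herm_proj F k)) P; rewrite dP => e.
set K := (P :&: _)%VS in e; rewrite -(leq_add2l (\dim K)) e -[X in (_ <= X)%N]/(1 + 2)%N leq_add2r.
apply: (@leq_trans (\dim <[Id]>)); last by rewrite dim_vline; case: (_ != 0).
apply: dimvS; apply/subvP => x; rewrite memv_cap memv_ker lfunE /= => /andP[_].
by rewrite herm_projE subr_eq0 => /eqP->; rewrite memvZ ?memv_line.
Qed.

Lemma dim_lineX X : (\dim (lineX X) <= 2)%N.
Proof.
by apply: (leq_trans (dimv_add_leqif _ _)); rewrite !dim_vline; case: (_ != 0); case: (_ != 0).
Qed.

Lemma lineX_proj X (P : {vspace J}) : \dim P = 3%N ->
  (linfun (@herm_proj F k) @: P <= lineX X)%VS ->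
  lineX X = (linfun (@herm_proj F k) @: P)%VS /\ \dim (lineX X) = 2%N.
Proof.
move=> dP sub; have d2 := dim_proj dP; have dl := dim_lineX X.
have eq : (linfun (@herm_proj F k) @: P)%VS = lineX X.
  by apply/eqP; rewrite eqEdim sub (leq_trans dl).
by split=> //; apply/eqP; rewrite eqn_leq dl -eq.
Qed.

Definition idem X (a b c : F) : J :=
  let D := (a - b) * (a - c) in el X (b * c / D) (- (b + c) / D) D^-1.

Lemma idem_mul X (a b c : F) : herm_tr X = 0 -> a + b + c = 0 ->
  a * b + a * c + b * c = herm_s X -> a * b * c = herm_det X ->
  a != b -> a != c -> b != c ->
  [/\ jp (idem X a b c) (idem X a b c) = idem X a b c,
      jp (idem X a b c) (idem X b a c) = 0,
      herm_tr (idem X a b c) = 1,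
      idem X a c b = idem X a b c &
      idem X a b c + idem X b a c + idem X c a b = Id].
Proof.
move=> trX h0 hs_ hd_ ab ac bc; rewrite -subr_eq0 in ab; rewrite -subr_eq0 in ac.
rewrite -subr_eq0 in bc.
have cE : c = - a - b by rewrite -[RHS]addr0 -h0; ring.
have ac2 : a - (- a - b) != 0 by rewrite -cE.
have bc2 : b - (- a - b) != 0 by rewrite -cE.
have ba : b - a != 0 by rewrite -opprB oppr_eq0.
have ca2 : - a - b - a != 0 by rewrite -cE -opprB oppr_eq0.
have cb2 : - a - b - b != 0 by rewrite -cE -opprB oppr_eq0.
rewrite /idem !el_mul // el_tr // -hs_ -hd_ cE.
split.
- by congr (el X _ _ _); field; rewrite ?ab ?ac2.
- by rewrite -[RHS](_ : el X 0 0 0 = 0); [congr (el X _ _ _); field; rewrite ?ab ?ba ?ac2 ?bc2|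
    rewrite /el /lc3 !scale0r !addr0].
- by field; rewrite ?ab ?ac2.
- by congr (el X _ _ _); field; rewrite ?ab ?ac2.
have [eI _ _] := lc3_basis Id X (jp X X).
rewrite [RHS]eI /el !lc3D; congr lc3; field; rewrite ?ab ?ba ?ac2 ?bc2 ?ca2 ?cb2 //.
Qed.

End Generators.

Section ReductionLines.
Variable F : numClosedFieldType.
Variable k : nat.
Hypothesis hk : (k <= 3)%N.
Local Notation J := (herm3 F k).
Local Notation Id := (herm_id F k).
Local Notation proj := (linfun (@herm_proj F k)).
Local Notation cone := (@severi_cone F k).
Implicit Types X Y Z : J.

Definition herm_disc X : F := 4%:R * herm_s X ^+ 3 + 27%:R * herm_det X ^+ 2.

Lemma frame3_reduction X u1 u2 u3 : herm_tr X = 0 ->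
  [/\ jp u1 u1 = u1, jp u2 u2 = u2 & jp u3 u3 = u3] ->
  [/\ jp u1 u2 = 0, jp u1 u3 = 0 & jp u2 u3 = 0] ->
  [/\ herm_tr u1 = 1, herm_tr u2 = 1 & herm_tr u3 = 1] ->
  u1 + u2 + u3 = Id ->
  [/\ herm_proj u1 \in lineX X, herm_proj u2 \in lineX X & herm_proj u3 \in lineX X] ->
  exists2 U : grassmannian2 (herm_traceless F k), reduction_line U & val U = lineX X.
Proof.
move=> trX [s1 s2 s3] [o12 o13 o23] [t1 t2 t3] su [m1 m2 m3].
pose e (i : 'I_3) : J := [:: u1; u2; u3]`_i.
have [e0 e1 e2] : [/\ e (inord 0) = u1, e (inord 1) = u2 & e (inord 2) = u3].
  by rewrite /e !inordK.
have ne (i j : nat) : (i < 3)%N -> (j < 3)%N -> (inord i == inord j :> 'I_3) = (i == j).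
  by move=> hi hj; rewrite -val_eqE /= !inordK.
have E := (e0, e1, e2); clearbody e.
have eM i j : jp (e i) (e j) = (i == j)%:R *: e i.
  by move: i j; apply: ord3P; apply: ord3P; rewrite !E ne //= ?scale1r ?scale0r // jpC.
have e_tr i : herm_tr (e i) = 1 by move: i; apply: ord3P; rewrite E.
have e_sum : \sum_i e i = Id by rewrite sum3E !E.
have e_mem i : herm_proj (e i) \in lineX X by move: i; apply: ord3P; rewrite E.
have dP := frame_dim eM e_tr.
have sub : (proj @: frame_space e <= lineX X)%VS.
  apply/subvP => _ /memv_imgP[y /frameP[c ->] ->]; rewrite lfunE /= herm_proj_sum.
  apply: memv_suml => i _; rewrite herm_projZ; apply: memvZ; exact: e_mem.
have [eqP d2] := lineX_proj dP sub.
have UP : (lineX X <= herm_traceless F k)%VS && (\dim (lineX X) == 2%N).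
  by rewrite lineX_traceless // d2.
exists (Sub (lineX X) UP); last by [].
exists (frame_space e); split=> //.
- exact: frame_simply_3secant.
- exact: frame_id.
Qed.

(* [- herm_disc X] is the discriminant of the characteristic polynomial of [X];
   when it does not vanish, the spectral idempotents of [X] form a frame. *)
Lemma lineX_reduction X : herm_tr X = 0 -> herm_disc X != 0 ->
  exists2 U : grassmannian2 (herm_traceless F k), reduction_line U & val U = lineX X.
Proof.
move=> trX dX; have [l1 [l2 [l3 [h1 h2 h3]]]] := cubic_roots (herm_s X) (herm_det X).
have dE : herm_disc X = - ((l1 - l2) * (l1 - l3) * (l2 - l3)) ^+ 2.
  have e : l3 = - l1 - l2 by rewrite -[RHS]addr0 -h1; ring.
  by rewrite /herm_disc -h2 -h3 e; ring.
have [n12 n13 n23] : [/\ l1 != l2, l1 != l3 & l2 != l3].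
  by split; apply: contraNneq dX => h; rewrite dE h subrr ?(mul0r, mulr0) expr0n oppr0.
have rot a b c : a + b + c = 0 -> a * b + a * c + b * c = herm_s X -> a * b * c = herm_det X ->
    [/\ b + c + a = 0, b * c + b * a + c * a = herm_s X & b * c * a = herm_det X].
  by move=> <- <- <-; split; ring.
have [h1' h2' h3'] := rot _ _ _ h1 h2 h3; have [h1'' h2'' h3''] := rot _ _ _ h1' h2' h3'.
have n21 : l2 != l1 by rewrite eq_sym.
have n31 : l3 != l1 by rewrite eq_sym.
have n32 : l3 != l2 by rewrite eq_sym.
have [s1 o12 t1 y1 su] := idem_mul hk trX h1 h2 h3 n12 n13 n23.
have [s2 o23 t2 y2 _] := idem_mul hk trX h1' h2' h3' n23 n21 n31.
have [s3 o31 t3 y3 _] := idem_mul hk trX h1'' h2'' h3'' n31 n32 n12.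
rewrite y2 in o12 su; rewrite y3 in o23; rewrite y1 in o31.
have m a b c : herm_proj (idem X a b c) \in lineX X by exact: el_lineX.
move: (m l1 l2 l3) (m l2 l3 l1) (m l3 l1 l2) su s1 s2 s3 o12 o23 o31 t1 t2 t3.
move: (idem X l1 l2 l3) (idem X l2 l3 l1) (idem X l3 l1 l2) => u1 u2 u3.
move=> m1 m2 m3 su s1 s2 s3 o12 o23; rewrite jpC => o31 t1 t2 t3.
exact: (frame3_reduction trX (And3 s1 s2 s3) (And3 o12 o31 o23) (And3 t1 t2 t3) su (And3 m1 m2 m3)).
Qed.

Lemma severi_coneZ a X : cone X -> cone (a *: X).
Proof.
move=> /severi_coneE e; apply/severi_coneE.
by rewrite jpZl jpZr e herm_trZ !scalerA; congr (_ *: _); ring.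
Qed.

Lemma cone_pencil X Y a b : cone X -> cone Y -> a != 0 -> b != 0 -> cone (a *: X + b *: Y) ->
  forall c, cone (X + c *: Y).
Proof.
move=> /severi_coneE eX /severi_coneE eY a0 b0 /severi_coneE e c; apply/severi_coneE.
have h : 2%:R *: jp X Y = herm_tr X *: Y + herm_tr Y *: X.
  apply: (scalerI (mulf_neq0 a0 b0)); move: e; rewrite !jpE (jpC Y X) eX eY !herm_trD !herm_trZ.
  move: (jp X Y) (herm_tr X) (herm_tr Y) => W t u; move: X Y {eX eY} => X Y.
  have [h1 h2 h3] := lc3_basis X Y W.
  have eD := lc3D X Y W; have eZ := lc3Z X Y W; have eN := lc3N X Y W.
  move/eqP; rewrite -subr_eq0 => /eqP h; apply/eqP; rewrite -subr_eq0; apply/eqP; rewrite -[RHS]h.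
  move: (lc3 X Y W) h1 h2 h3 eD eZ eN {h} => lc h1 h2 h3 eD eZ eN.
  by rewrite h1 h2 h3 !(eZ, eN, eD); congr (lc _ _ _); ring.
have W : jp X Y = 2%:R^-1 *: (herm_tr X *: Y + herm_tr Y *: X).
  by rewrite -h scalerA mulVf ?scale1r // pnatr_eq0.
rewrite !jpE (jpC Y X) eX eY !herm_trD !herm_trZ W.
move: (herm_tr X) (herm_tr Y) {eX eY h e W} => t u.
have [h1 h2 _] := lc3_basis X Y 0.
have eD := lc3D X Y 0; have eZ := lc3Z X Y 0.
move: (lc3 X Y 0) h1 h2 eD eZ => lc h1 h2 eD eZ.
by rewrite h1 h2 !(eZ, eD); congr (lc _ _ _); field.
Qed.

End ReductionLines.

Section SecantPlanes.
Variable F : numClosedFieldType.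
Variable k : nat.
Hypothesis hk : (k <= 3)%N.
Local Notation J := (herm3 F k).
Local Notation Id := (herm_id F k).
Local Notation proj := (linfun (@herm_proj F k)).
Local Notation cone := (@severi_cone F k).
Implicit Types X Y Z : J.

Lemma proj_point_line X : X != 0 -> cone X -> proj_point cone <[X]>%VS.
Proof.
move=> X0 traceless_of; split=> [|x /vlineP[a ->]]; first by rewrite dim_vline X0.
exact: severi_coneZ.
Qed.

Lemma pencil_lines_inj X Y c c' : Y != 0 -> X \notin <[Y]>%VS ->
  X + c *: Y \in <[X + c' *: Y]>%VS -> c = c'.
Proof.
move=> Y0 XY /vlineP[a e].
have e' : (1 - a) *: X = (a * c' - c) *: Y.
  apply/eqP; rewrite -subr_eq0; apply/eqP.
  move/eqP: e; rewrite -subr_eq0 => /eqP e; rewrite -[RHS]e.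
  have [h1 h2 _] := lc3_basis X Y 0.
  have eD := lc3D X Y 0; have eZ := lc3Z X Y 0; have eN := lc3N X Y 0.
  move: (lc3 X Y 0) h1 h2 eD eZ eN => lc h1 h2 eD eZ eN.
  by rewrite h1 h2 !(eZ, eN, eD); congr (lc _ _ _); ring.
have a1 : 1 - a = 0.
  apply: contraNeq XY => a1; rewrite -(scale1r X) -(mulVf a1) -scalerA e' scalerA.
  by rewrite memvZ ?memv_line.
move: e'; rewrite a1 scale0r => /esym/eqP; rewrite scaler_eq0 (negPf Y0) orbF.
have -> : a = 1 by apply/eqP; rewrite eq_sym -subr_eq0 a1.
by rewrite mul1r subr_eq0 => /eqP.
Qed.

Lemma line_eq X Y : X != 0 -> X \in <[Y]>%VS -> <[X]>%VS = <[Y]>%VS.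
Proof.
move=> X0 XY; apply/eqP; rewrite eqEdim -memvE XY !dim_vline X0.
by case: (_ != 0).
Qed.

Lemma secant_frame (P : {vspace J}) : simply_3secant cone P ->
  exists X1 X2 X3, [/\ cone X1, cone X2, cone X3 & P = (<[X1]> + <[X2]> + <[X3]>)%VS].
Proof.
move=> [dP [s [us ss hs' _]]].
have gen L : L \in s -> exists X, [/\ X != 0, L = <[X]>%VS, cone X & X \in P].
  move=> /hs'[[dL cL] sL]; have L0 : L != 0%VS by rewrite -dimv_eq0 dL.
  exists (vpick L); have pL := memv_pick L; have p0 : vpick L != 0 by rewrite vpick0.
  split=> //; last by [exact: (subvP sL)]; last exact: cL.
  by apply/esym/eqP; rewrite eqEdim -memvE pL dL dim_vline p0.
case: s us ss hs' gen => [|L1 [|L2 [|L3 [|]]]] // us _ hs' gen.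
have [X1 [n1 e1 c1 p1]] := gen L1 (mem_head _ _).
have [X2 [n2 e2 c2 p2]] := gen L2 ltac:(by rewrite !inE eqxx orbT).
have [X3 [n3 e3 c3 p3]] := gen L3 ltac:(by rewrite !inE eqxx !orbT).
move: us; rewrite /= !inE negb_or andbT e1 e2 e3 => /andP[/andP[d12 d13] d23].
have out X Y : X != 0 -> <[X]>%VS != <[Y]>%VS -> X \notin <[Y]>%VS.
  by move=> X0; apply: contraNN => /(line_eq X0)->.
have o12 := out _ _ n1 d12; have o13 := out _ _ n1 d13; have o23 := out _ _ n2 d23.
exists X1, X2, X3; split=> //.
have o3 : X3 \notin (<[X1]> + <[X2]>)%VS.
  apply/negP => /memv_addP[_ /vlineP[a ->] [_ /vlineP[b ->] X3E]].
  have a0 : a != 0.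
    apply: contraNneq d23 => a0; rewrite eq_sym; apply/eqP; apply: line_eq => //.
    by rewrite X3E a0 scale0r add0r memvZ ?memv_line.
  have b0 : b != 0.
    apply: contraNneq d13 => b0; rewrite eq_sym; apply/eqP; apply: line_eq => //.
    by rewrite X3E b0 scale0r addr0 memvZ ?memv_line.
  rewrite X3E in c3; have cc := cone_pencil c1 c2 a0 b0 c3.
  pose M (i : nat) : {vspace J} := <[X1 + i%:R *: X2]>%VS.
  have nz i : X1 + i%:R *: X2 != 0.
    apply: contraNneq o12 => h; have -> : X1 = - (i%:R : F) *: X2.
      by rewrite scaleNr; apply/eqP; rewrite -addr_eq0 h.
    by rewrite memvZ ?memv_line.
  have uM : uniq [seq M i | i <- iota 0 4].
    rewrite map_inj_uniq ?iota_uniq // => i j h; apply/eqP; rewrite -(eqr_nat F); apply/eqP.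
    by apply: (pencil_lines_inj n2 o12); have := memv_line (X1 + i%:R *: X2); rewrite -/(M i) h.
  have sM : {subset [seq M i | i <- iota 0 4] <= [:: L1; L2; L3]}.
    move=> _ /mapP[i _ ->]; apply/hs'; split; first exact: proj_point_line.
    by rewrite -memvE rpredD ?memvZ.
  by have := uniq_leq_size uM sM.
apply/eqP; rewrite eq_sym eqEdim !subv_add -!memvE p1 p2 p3 /=.
rewrite (dim_line_add o3) dP; have -> : (<[X1]> + <[X2]> = <[X2]> + <[X1]>)%VS by rewrite addvC.
by rewrite (dim_line_add o12) dim_vline n2.
Qed.

Lemma id_not_rank2 X Y : cone X -> cone Y -> X + Y <> Id.
Proof.
move=> /severi_coneE eX /severi_coneE eY eXY.
have Id0 : Id != 0.
  by apply/eqP => h; have := herm_tr_id F k; rewrite h linear0 => /esym/eqP; rewrite pnatr_eq0.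
have YE : Y = Id - X by rewrite -eXY addrC addKr.
move: eY; rewrite YE herm_trD -[in herm_tr (- X)]scaleN1r herm_trZ herm_tr_id mulN1r.
rewrite !jpE !jp_id (jpC X) jp_id eX; set t := herm_tr X => h.
have XE : X = (2%:R - t) *: Id.
  apply/eqP; rewrite -subr_eq0; apply/eqP; move/eqP: h; rewrite -subr_eq0 => /eqP h.
  rewrite -[RHS]h; clear; clearbody t.
  have [h1 h2 _] := lc3_basis X Id 0.
  have eD := lc3D X Id 0; have eZ := lc3Z X Id 0; have eN := lc3N X Id 0.
  move: (lc3 X Id 0) h1 h2 eD eZ eN => lc h1 h2 eD eZ eN.
  by rewrite h1 h2 !(eZ, eN, eD); congr (lc _ _ _); ring.
have tE : t = (2%:R - t) * 3%:R by rewrite /t {1}XE herm_trZ herm_tr_id.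
move: eX; rewrite -/t XE jpZl jpZr jp_id !scalerA => /eqP.
rewrite -subr_eq0 -scalerBl scaler_eq0 (negPf Id0) orbF => /eqP h'.
have [u uE] : exists u, u = 2%:R - t by eexists.
rewrite -uE in tE h'; rewrite tE in h'.
have u0 : u = 0.
  have : 2%:R * (u * u) = 0 by rewrite -[RHS]oppr0 -h'; ring.
  by move/eqP; rewrite !mulf_eq0 pnatr_eq0 orbb => /eqP.
by move: uE; rewrite tE u0 mul0r subr0 => /esym/eqP; rewrite pnatr_eq0.
Qed.

(* With [Id = e1 + e2 + e3] and [jp ei ei = ti ei], the coordinates of [1], [X]
   and [X^2] for [X = e1 - e2] form a matrix of determinant [2], whatever the [ti]. *)
Lemma reduction_lineX (U : grassmannian2 (herm_traceless F k)) : reduction_line U ->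
  exists2 X, herm_tr X = 0 & val U = lineX X.
Proof.
move=> [P [sP IP UE]]; have dP := sP.1.
have [X1 [X2 [X3 [c1 c2 c3 PE]]]] := secant_frame sP.
have [e1 [e2 [e3 [d1 d2 d3 [IE [p1 p2 p3]]]]]] : exists e1 e2 e3, [/\ cone e1, cone e2, cone e3 &
    Id = e1 + e2 + e3 /\
    [/\ (<[X1]> = <[e1]>)%VS, (<[X2]> = <[e2]>)%VS & (<[X3]> = <[e3]>)%VS]].
  have := IP; rewrite PE => /memv_addP[_ /memv_addP[_ /vlineP[a ->] [_ /vlineP[b ->] ->]] [_
      /vlineP[c ->] IE]].
  have ln (d : F) X : d != 0 -> <[X]>%VS = <[d *: X]>%VS.
    move=> d0; apply/eqP; rewrite eqEsubv -!memvE memvZ ?memv_line // andbT.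
    by rewrite -{1}(scale1r X) -(mulVf d0) -scalerA memvZ ?memv_line.
  have ca := severi_coneZ a c1; have cb := severi_coneZ b c2; have cc := severi_coneZ c c3.
  exists (a *: X1), (b *: X2), (c *: X3); split=> //; split=> //; split; apply: ln; apply/eqP => z.
  - by apply: (id_not_rank2 cb cc); rewrite IE z scale0r add0r.
  - by apply: (id_not_rank2 ca cc); rewrite IE z scale0r addr0.
  - by apply: (id_not_rank2 ca cb); rewrite IE z scale0r addr0.
rewrite p1 p2 p3 in PE => {p1 p2 p3 c1 c2 c3 X1 X2 X3 sP IP}.
have /severi_coneE := d1; set t1 := herm_tr e1 => s1.
have /severi_coneE := d2; set t2 := herm_tr e2 => s2.
have /severi_coneE := d3; set t3 := herm_tr e3 => s3.
have ts : t1 + t2 + t3 = 3%:R by rewrite -(herm_tr_id F k) IE !herm_trD.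
have par : jp (e1 - e2) (e1 - e2) = 2%:R *: jp e1 e1 + 2%:R *: jp e2 e2 - jp (e1 + e2) (e1 + e2).
  rewrite !jpE (jpC e2 e1).
  have [h1 h2 h3] := lc3_basis (jp e1 e1) (jp e1 e2) (jp e2 e2).
  move: (lc3D (jp e1 e1) (jp e1 e2) (jp e2 e2)) (lc3Z (jp e1 e1) (jp e1 e2) (jp e2 e2))
    (lc3N (jp e1 e1) (jp e1 e2) (jp e2 e2)).
  move: (lc3 _ _ _) h1 h2 h3 => lc -> -> -> eD eZ eN.
  by rewrite !(eZ, eN, eD); congr (lc _ _ _); ring.
have sq3 : jp (e1 + e2) (e1 + e2) = Id - 2%:R *: e3 + t3 *: e3.
  have -> : e1 + e2 = Id - e3 by rewrite IE addrK.
  rewrite jpDl jpNl jp_id jpDr jpNr s3 (jpC e3) jp_id scaler_nat mulr2n.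
  by rewrite ?opprD ?opprK ?addrA.
have [X XE] : exists X, X = herm_proj (e1 - e2) by eexists.
have trX : herm_tr X = 0 by rewrite XE herm_tr_proj.
pose S := jp (e1 - e2) (e1 - e2).
pose tau := 3%:R^-1 * herm_tr (e1 - e2).
have X0E : e1 - e2 = X + tau *: Id by rewrite XE herm_projE subrK.
have XX : X \in lineX X by rewrite -[X in X \in _]addr0 memv_add ?mem0v ?memv_line.
have XX2 : herm_proj (jp X X) \in lineX X.
  by rewrite -[X in X \in _]add0r memv_add ?mem0v ?memv_line.
have pS : herm_proj S \in lineX X.
  rewrite /S X0E !jpE !jp_id (jpC X Id) jp_id !herm_projD !herm_projZ herm_proj_id.
  rewrite (herm_proj_traceless trX) !scaler0 addr0.
  by apply: memvD; [apply: memvD => //|]; apply: memvZ.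
have E1 : 2%:R *: e1 = S - (1 - t3) *: Id + (1 - t1 + t2) *: (e1 - e2).
  rewrite /S par sq3 s1 s2 IE.
  have [h1 h2 h3] := lc3_basis e1 e2 e3.
  move: (lc3D e1 e2 e3) (lc3Z e1 e2 e3) (lc3N e1 e2 e3).
  move: (lc3 e1 e2 e3) h1 h2 h3 => lc h1 h2 h3 eD eZ eN.
  rewrite h1 h2 h3 !(eZ, eN, eD); have t1E : t1 = 3%:R - t2 - t3 by rewrite -ts; ring.
  by rewrite t1E; congr (lc _ _ _); ring.
have m1 : herm_proj e1 \in lineX X.
  have -> : e1 = 2%:R^-1 *: (2%:R *: e1) by rewrite scalerA mulVf ?scale1r // pnatr_eq0.
  rewrite E1 herm_projZ !herm_projD -scaleNr !herm_projZ herm_proj_id scaler0 addr0 -XE.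
  by apply: memvZ; apply: memvD => //; apply: memvZ.
have m2 : herm_proj e2 \in lineX X.
  have -> : e2 = e1 + (-1) *: (e1 - e2) by rewrite scaleN1r opprB addrC subrK.
  by rewrite (herm_projD e1) (herm_projZ _ (e1 - e2)) -XE; apply: memvD => //; apply: memvZ.
have m3 : herm_proj e3 \in lineX X.
  have -> : e3 = Id + (-1) *: (e1 + e2) by rewrite scaleN1r IE addrC addKr.
  rewrite (herm_projD Id) (herm_projZ _ (e1 + e2)) herm_proj_id add0r (herm_projD e1).
  by apply: memvZ; apply: memvD.
exists X => //; rewrite UE; apply/esym; apply: (lineX_proj dP _).1.
apply/subvP => _ /memv_imgP[y yP ->]; move: yP; rewrite PE lfunE /=.
move=> /memv_addP[_ /memv_addP[_ /vlineP[a ->] [_ /vlineP[b ->] ->]] [_ /vlineP[c ->] ->]].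
rewrite (herm_projD (_ + _)) (herm_projD (_ *: e1)) (herm_projZ _ e1) (herm_projZ _ e2)
    (herm_projZ _ e3).
by apply: memvD; [apply: memvD|]; apply: memvZ.
Qed.

End SecantPlanes.

(** * Algebras of functions *)

Section FunAlg.
Variables (F : fieldType) (T : Type).

Record funalg (R : (T -> F) -> Prop) : Prop := FunAlg {
  fa_ext : forall f g, R f -> f =1 g -> R g;
  fa_cst : forall c, R (fun=> c);
  fa_add : forall f g, R f -> R g -> R (fun x => f x + g x);
  fa_mul : forall f g, R f -> R g -> R (fun x => f x * g x) }.

Variable R : (T -> F) -> Prop.
Hypothesis RP : funalg R.

Lemma fa_opp f : R f -> R (fun x => - f x).
Proof.
move=> Rf; apply: (fa_ext RP (fa_mul RP (fa_cst RP (-1)) Rf)) => x /=.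
exact: mulN1r.
Qed.

Lemma fa_sub f g : R f -> R g -> R (fun x => f x - g x).
Proof. by move=> Rf Rg; apply: (fa_add RP) Rf (fa_opp Rg). Qed.

Lemma fa_sum I (r : seq I) (f : I -> T -> F) :
  (forall i, R (f i)) -> R (fun x => \sum_(i <- r) f i x).
Proof.
move=> Rf; elim: r => [|i r IH].
  by apply: (fa_ext RP (fa_cst RP 0)) => x; rewrite big_nil.
by apply: (fa_ext RP (fa_add RP (Rf i) IH)) => x; rewrite big_cons.
Qed.

Lemma fa_prod I (r : seq I) (f : I -> T -> F) :
  (forall i, R (f i)) -> R (fun x => \prod_(i <- r) f i x).
Proof.
move=> Rf; elim: r => [|i r IH].
  by apply: (fa_ext RP (fa_cst RP 1)) => x; rewrite big_nil.
by apply: (fa_ext RP (fa_mul RP (Rf i) IH)) => x; rewrite big_cons.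
Qed.

Lemma fa_exp f n : R f -> R (fun x => f x ^+ n).
Proof.
move=> Rf; elim: n => [|n IH]; first by apply: (fa_ext RP (fa_cst RP 1)).
by apply: (fa_ext RP (fa_mul RP Rf IH)) => x; rewrite exprS.
Qed.

Lemma fa_meval n (f : 'I_n -> T -> F) (p : {mpoly F[n]}) :
  (forall i, R (f i)) -> R (fun x => p.@[fun i => f i x]).
Proof.
move=> Rf; apply: (fa_ext RP (f := fun x => \sum_(m <- msupp p) p@_m * \prod_i f i x ^+ m i)).
  apply: fa_sum => m; apply: (fa_mul RP) (fa_cst RP _) _.
  by apply: fa_prod => i; apply: fa_exp.
by move=> x; rewrite mevalE.
Qed.

Section VectorValued.
Variable V : vectType F.

Definition vmap (c : T -> V) := forall i, R (fun x => lin_coord (c x) i).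

Lemma vmap_ext c c' : vmap c -> c =1 c' -> vmap c'.
Proof. by move=> h e i; apply: (fa_ext RP (h i)) => x; rewrite e. Qed.

Lemma vmap_cst v : vmap (fun=> v).
Proof. by move=> i; apply: (fa_cst RP). Qed.

Lemma vmapD c c' : vmap c -> vmap c' -> vmap (fun x => c x + c' x).
Proof.
move=> h h' i; apply: (fa_ext RP (fa_add RP (h i) (h' i))) => x.
by rewrite /lin_coord linearD.
Qed.

Lemma vmapZ f c : R f -> vmap c -> vmap (fun x => f x *: c x).
Proof.
move=> h h' i; apply: (fa_ext RP (fa_mul RP h (h' i))) => x.
by rewrite /lin_coord linearZ.
Qed.

Lemma vmapN c : vmap c -> vmap (fun x => - c x).
Proof.
move=> h; apply: (vmap_ext (vmapZ (fa_cst RP (-1)) h)) => x; exact: scaleN1r.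
Qed.

Lemma vmapB c c' : vmap c -> vmap c' -> vmap (fun x => c x - c' x).
Proof. by move=> h h'; apply: vmapD h (vmapN h'). Qed.

Lemma linear_lin_coord_sum (W : lmodType F) (L : V -> W) (x : V) : linear L ->
  L x = \sum_i lin_coord x i *: L (vbasis {:V})`_i.
Proof.
move=> lL; pose L' : {linear V -> W} := HB.pack L (GRing.isLinear.Build F V W *:%R L lL).
have E y : L y = L' y by [].
rewrite E {1}(lin_coord_sum x) linear_sum; apply: eq_bigr => i _.
by rewrite linearZ E.
Qed.

Lemma fa_form (L : V -> F^o) c : linear L -> vmap c -> R (fun x => L (c x)).
Proof.
move=> lL h; apply: (fa_ext RP (f := fun x => \sum_i lin_coord (c x) i * L (vbasis {:V})`_i)).
  by apply: fa_sum => i; apply: (fa_mul RP) (h i) (fa_cst RP _).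
by move=> x; rewrite (linear_lin_coord_sum _ lL).
Qed.

Lemma fa_bilinear (B : V -> V -> F^o) c c' :
  (forall z, linear (B ^~ z)) * (forall z, linear (B z)) ->
  vmap c -> vmap c' -> R (fun x => B (c x) (c' x)).
Proof.
move=> BP h h'; apply: (fa_ext RP (f := fun x =>
  \sum_i \sum_j (lin_coord (c x) i * lin_coord (c' x) j) * B (vbasis {:V})`_i (vbasis {:V})`_j)).
  apply: fa_sum => i; apply: fa_sum => j; apply: (fa_mul RP) _ (fa_cst RP _).
  exact: (fa_mul RP).
by move=> x; rewrite (bilinear_sum BP).
Qed.

End VectorValued.

Lemma vmap_linear (V W : vectType F) (L : V -> W) c : linear L -> vmap c -> vmap (fun x => L (c x)).
Proof.
move=> lL h i; apply: (fa_form (L := fun y => lin_coord (L y) i) _ h) => a x y.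
by rewrite lL /lin_coord linearP.
Qed.

Lemma vmap_bilinear (V W : vectType F) (B : V -> V -> W) c c' :
  (forall z, linear (B ^~ z)) * (forall z, linear (B z)) ->
  vmap c -> vmap c' -> vmap (fun x => B (c x) (c' x)).
Proof.
move=> BP h h' i; apply: (fa_bilinear (B := fun y z => lin_coord (B y z) i) _ h h').
by split=> z a x y; rewrite ?(BP.1 z) ?(BP.2 z) /lin_coord linearP.
Qed.

Lemma vmap_row n (c : T -> 'rV[F]_n) : (forall i, R (fun x => c x 0 i)) -> vmap c.
Proof.
move=> h; apply: (vmap_ext (c := fun x => \sum_i c x 0 i *: delta_mx 0 i)); last first.
  by move=> x; rewrite -row_sum_delta.
move=> j; apply: (fa_ext RP (f := fun x => \sum_i c x 0 i * lin_coord (delta_mx 0 i : 'rV[F]_n) j)).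
  by apply: fa_sum => i; apply: (fa_mul RP) (h i) (fa_cst RP _).
by move=> x; rewrite /lin_coord linear_sum; apply: eq_bigr => i _; rewrite linearZ.
Qed.

Lemma vmap_rowE n (c : T -> 'rV[F]_n) i : vmap c -> R (fun x => c x 0 i).
Proof. by move=> h; apply: (fa_form (L := fun y : 'rV[F]_n => y 0 i) _ h) => a x y; rewrite !mxE.
    Qed.

End FunAlg.

Section PolynomialFunctions.
Variable F : numFieldType.

Definition pfun n (f : 'rV[F]_n -> F) := exists p : {mpoly F[n]}, forall x, f x = p.@[fun i => x
    0 i].

Lemma pfun_alg n : funalg (@pfun n).
Proof.
split=> [f g [p h] e|c|f g [p hp] [q hq]|f g [p hp] [q hq]].
- by exists p => x; rewrite -e.
- by exists c%:MP => x; rewrite mevalC.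
- by exists (p + q) => x; rewrite mevalD hp hq.
- by exists (p * q) => x; rewrite mevalM hp hq.
Qed.

Lemma pfun_coord n (i : 'I_n) : pfun (fun x => x 0 i).
Proof. by exists 'X_i => x; rewrite mevalXU. Qed.

Definition pfun1 (f : F -> F) := exists p : {poly F}, forall t, f t = p.[t].

Lemma pfun1_alg : funalg pfun1.
Proof.
split=> [f g [p h] e|c|f g [p hp] [q hq]|f g [p hp] [q hq]].
- by exists p => x; rewrite -e.
- by exists c%:P => x; rewrite hornerC.
- by exists (p + q) => x; rewrite hornerD hp hq.
- by exists (p * q) => x; rewrite hornerM hp hq.
Qed.

Lemma poly_eval0 (p : {poly F}) : (forall t, p.[t] = 0) -> p = 0.
Proof.
move=> h; apply/eqP/contraT => p0.
have inj : injective (fun i : nat => i%:R : F) by move=> i j /eqP; rewrite eqr_nat => /eqP.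
have := max_poly_roots p0 (rs := [seq i%:R | i <- iota 0 (size p)]).
rewrite size_map size_iota ltnn map_inj_uniq ?iota_uniq // => -> //.
by apply/allP => x _; apply/rootP.
Qed.

Lemma pfun_line n (f : 'rV[F]_n -> F) (u v : 'rV[F]_n) :
  pfun f -> pfun1 (fun t => f (u + t *: v)).
Proof.
move=> [p h]; apply: (fa_ext pfun1_alg (f := fun t => p.@[fun i => u 0 i + t * v 0 i])).
  apply: (fa_meval pfun1_alg) => i; apply: (fa_add pfun1_alg); first exact: (fa_cst pfun1_alg).
  by apply: (fa_mul pfun1_alg); [exists 'X => t; rewrite hornerX | exact: (fa_cst pfun1_alg)].
by move=> t; rewrite h; apply: meval_eq => i; rewrite !mxE.
Qed.

Lemma pfun_dense n (f g : 'rV[F]_n -> F) (u : 'rV[F]_n) : pfun f -> pfun g -> g u != 0 ->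
  (forall v, g v != 0 -> f v = 0) -> forall v, f v = 0.
Proof.
move=> hf hg gu h v; have [p hp] := pfun_line u (v - u) hf; have [q hq] := pfun_line u (v - u) hg.
have : p * q = 0.
  apply: poly_eval0 => t; rewrite hornerM -hp -hq.
  by have [->|/h->] := eqVneq (g (u + t *: (v - u))) 0; rewrite ?mulr0 ?mul0r.
move/eqP; rewrite mulf_eq0 => /orP[/eqP p0|/eqP q0].
  by have := hp 1; rewrite p0 horner0 scale1r addrC subrK.
by have := hq 0; rewrite q0 horner0 scale0r addr0 => e; rewrite e eqxx in gu.
Qed.

End PolynomialFunctions.

(** * Closed subsets and functions on the Grassmannian *)

Section ClosedSets.
Variables (F : fieldType) (T : formSpace F).

Lemma zclosed_ext (Z Z' : T -> Prop) : zclosed Z -> (forall x, Z x <-> Z' x) -> zclosed Z'.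
Proof. by move=> [S h1 h2] e; exists S => // x; rewrite -e. Qed.

Lemma zclosed_form d (f : T -> F) : is_form d f -> zclosed (fun x => f x = 0).
Proof.
move=> hf; exists (fun e g => e = d /\ g = f) => [e g [-> ->] //|x].
by split=> [h e g [_ ->] //|]; apply.
Qed.

Lemma zclosed_all I (Z : I -> T -> Prop) :
  (forall i, zclosed (Z i)) -> zclosed (fun x => forall i, Z i x).
Proof.
move=> h; exists (fun d f => is_form d f /\ exists i, forall x, Z i x -> f x = 0).
  by move=> d f [].
move=> x; split=> [Zx d f [_ [i hi]]|hx i]; first exact: hi.
have [S hS ZS] := h i; apply/ZS => d f Sf; apply: (hx d f); split; first exact: hS.
by exists i => y /ZS/(_ d f Sf).
Qed.

Lemma sub_zclosure (A : T -> Prop) x : A x -> zclosure A x.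
Proof. by move=> Ax Z _; apply. Qed.

Lemma zclosure_trans (A B : T -> Prop) x :
  (forall y, A y -> zclosure B y) -> zclosure A x -> zclosure B x.
Proof. by move=> h Ax Z cZ BZ; apply: Ax => // y /h; apply. Qed.

End ClosedSets.

Section Grassmannian.
Variables (F : numFieldType) (V : vectType F) (W : {vspace V}).
Local Notation T := (grassmannian2 W).
Local Notation d := (\dim {:V}).

Definition wedge (u v : V) : 'M[F]_d :=
  \matrix_(i, j) (lin_coord u i * lin_coord v j - lin_coord u j * lin_coord v i).

Definition gbase (U : T) (i : nat) : V := (vbasis (val U))`_i.

Lemma pluckerE (U : T) : pluecker (val U) = wedge (gbase U 0) (gbase U 1).
Proof. by []. Qed.

Lemma gbaseE (U : T) : vbasis (val U) = [:: gbase U 0; gbase U 1] :> seq V.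
Proof.
have /andP[_ /eqP dU] := valP U; rewrite /gbase.
have : size (vbasis (val U)) = 2%N by rewrite size_tuple.
by case: (tval _) => [|a [|b []]].
Qed.

Lemma gbase_span (U : T) : val U = (<[gbase U 0]> + <[gbase U 1]>)%VS.
Proof.
by rewrite -[LHS](span_basis (vbasisP (val U))) gbaseE span_cons span_seq1.
Qed.

Lemma gr2_dim (U : T) : \dim (val U) = 2%N.
Proof. by have /andP[_ /eqP] := valP U. Qed.

Lemma mem_plane (u v x : V) : x \in (<[u]> + <[v]>)%VS -> exists a b, x = a *: u + b *: v.
Proof. by move=> /memv_addP[_ /vlineP[a ->] [_ /vlineP[b ->] ->]]; exists a, b. Qed.

Lemma dim_plane_lt (u v : V) a b : (a, b) != (0, 0) -> a *: u + b *: v = 0 ->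
  (\dim (<[u]> + <[v]>)%VS <= 1)%N.
Proof.
have key (x y : V) c e : c != 0 -> c *: x + e *: y = 0 -> (\dim (<[x]> + <[y]>)%VS <= 1)%N.
  move=> c0 h; apply: (@leq_trans (\dim <[y]>)); last by rewrite dim_vline; case: (_ != 0).
  apply: dimvS; rewrite subv_add subvv andbT -memvE.
  move/eqP: h; rewrite addr_eq0 => /eqP h.
  by rewrite -(scale1r x) -(mulVf c0) -scalerA h memvZ // memvN memvZ ?memv_line.
rewrite xpair_eqE negb_and => /orP[a0|b0] h; first exact: key a0 h.
by rewrite addvC; apply: (key v u b a b0); rewrite addrC.
Qed.

Lemma lin_coord_comb (a b : F) (u v : V) i :
  lin_coord (a *: u + b *: v) i = a * lin_coord u i + b * lin_coord v i.
Proof. by rewrite /lin_coord linearD !linearZ. Qed.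

Lemma wedge_comb (a b c e : F) (u v : V) :
  wedge (a *: u + b *: v) (c *: u + e *: v) = (a * e - b * c) *: wedge u v.
Proof.
by apply/matrixP => i j; rewrite ![wedge _ _ _ _]mxE [RHS]mxE [wedge _ _ _ _]mxE !lin_coord_comb;
    ring.
Qed.

Definition minor (f1 f2 : V -> F) (u v : V) : F := f1 u * f2 v - f1 v * f2 u.

Lemma minor_comb (f1 f2 : V -> F^o) (a b c e : F) (u v : V) : linear f1 -> linear f2 ->
  minor f1 f2 (a *: u + b *: v) (c *: u + e *: v) = (a * e - b * c) * minor f1 f2 u v.
Proof.
move=> l1 l2; have E (f : V -> F^o) x y (p q : F) : linear f -> f (p *: x + q *: y) = p * f x + q
    * f y :> F.
  move=> lf; have f0 : f 0 = 0 :> F^o.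
    by apply: (addrI (f 0)); rewrite addr0 -{1}[f 0]scale1r -lf scale1r addr0.
  by rewrite lf -[q *: y]addr0 lf f0 addr0.
by rewrite /minor !E //; ring.
Qed.

Lemma gbase_comb (U : T) (u v : V) : val U = (<[u]> + <[v]>)%VS -> exists2 del : F, del != 0 &
  exists a b c e : F, [/\ gbase U 0 = a *: u + b *: v, gbase U 1 = c *: u + e *: v &
    del = a * e - b * c].
Proof.
move=> UE; have dU := gr2_dim U; have bE := gbase_span U.
have mem i : (i < 2)%N -> gbase U i \in (<[u]> + <[v]>)%VS.
  move=> hi; rewrite -UE bE; case: i hi => [|[|//]] _.
    by rewrite -[X in X \in _]addr0 memv_add ?mem0v ?memv_line.
  by rewrite -[X in X \in _]add0r memv_add ?mem0v ?memv_line.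
have [a [b e0]] := mem_plane (mem 0%N isT); have [c [e e1]] := mem_plane (mem 1%N isT).
exists (a * e - b * c); last by exists a, b, c, e.
apply/eqP => D0; have no p q : (p, q) != (0, 0) -> p *: gbase U 0 + q *: gbase U 1 <> 0.
  by move=> pq /(dim_plane_lt pq); rewrite -bE dU.
have [] : (e == 0) && (b == 0) = true \/ (e, - b) != (0, 0).
- by rewrite xpair_eqE oppr_eq0; case: (_ && _); [left | right].
- move=> /andP[/eqP ez /eqP bz]; rewrite ez bz in e0 e1.
  have [] : (c == 0) && (a == 0) = true \/ (c, - a) != (0, 0).
  + by rewrite xpair_eqE oppr_eq0; case: (_ && _); [left | right].
  + move=> /andP[/eqP cz /eqP az]; apply: (no 1 0); first by rewrite xpair_eqE oner_eq0.
    by rewrite e0 az !scale0r !addr0 scaler0.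
  move=> /no; apply; rewrite e0 e1 !scale0r !addr0 !scalerA -scalerDl.
  by rewrite mulNr mulrC subrr scale0r.
move=> /no; apply; rewrite e0 e1 !scalerDr !scalerA addrACA -!scalerDl.
have -> : e * a + - b * c = 0 by rewrite -D0; ring.
have -> : e * b + - b * e = 0 by ring.
by rewrite !scale0r addr0.
Qed.

Lemma homog_meval n e (p : {mpoly F[n]}) (x : 'I_n -> F) (del : F) : p \is e.-homog ->
  p.@[fun i => del * x i] = del ^+ e * p.@[x].
Proof.
move=> /dhomogP hp; rewrite !mevalE mulr_sumr; rewrite !big_seq; apply: eq_bigr => m mp.
rewrite mulrCA; congr (_ * _); under eq_bigr => i _ do rewrite exprMn.
rewrite big_split /=; congr (_ * _).
by rewrite prodrXr -mdegE (hp m mp).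
Qed.

End Grassmannian.

Section GrassmannianForms.
Variables (F : numFieldType) (V : vectType F) (W : {vspace V}).
Local Notation T := (grassmannian2 W).
Local Notation d := (\dim {:V}).
Implicit Types (U : T) (u v : V).

Definition gminor (f1 f2 : V -> F) (U : T) : F := minor f1 f2 (gbase U 0) (gbase U 1).

Lemma plane_scale U u v : val U = (<[u]> + <[v]>)%VS -> exists2 del : F, del != 0 &
  pluecker (val U) = del *: wedge u v /\
  forall f1 f2 : V -> F^o, linear f1 -> linear f2 -> gminor f1 f2 U = del * minor f1 f2 u v.
Proof.
move=> /gbase_comb[del d0 [a [b [c [e [e0 e1 dE]]]]]]; exists del => //; split.
  by rewrite pluckerE e0 e1 wedge_comb dE.
by move=> f1 f2 l1 l2; rewrite /gminor e0 e1 minor_comb // dE.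
Qed.

Lemma form_wedge e (f : T -> F) : is_form e f -> exists p : {mpoly F[d * d]},
  forall U u v del, pluecker (val U) = del *: wedge u v ->
  f U = del ^+ e * p.@[fun m => mxvec (wedge u v) 0 m].
Proof.
move=> [p hp fE]; exists p => U u v del h; rewrite fE h -homog_meval //.
by apply: meval_eq => i; rewrite linearZ mxE.
Qed.

Lemma form_cst c : is_form 0 (fun _ : T => c).
Proof.
exists c%:MP => [|U]; last by rewrite mevalC.
by rewrite -[c%:MP]mulr1 mul_mpolyC; apply/dhomogZ/dhomog1.
Qed.

Lemma form_add e (f g : T -> F) : is_form e f -> is_form e g -> is_form e (fun U => f U + g U).
Proof.
move=> [p hp fE] [q hq gE]; exists (p + q); first exact: dhomogD.
by move=> U; rewrite mevalD fE gE.
Qed.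

Lemma form_mul e e' (f g : T -> F) :
  is_form e f -> is_form e' g -> is_form (e + e') (fun U => f U * g U).
Proof.
move=> [p hp fE] [q hq gE]; exists (p * q); first exact: dhomogM.
by move=> U; rewrite mevalM fE gE.
Qed.

Lemma form_exp e (f : T -> F) n : is_form e f -> is_form (e * n) (fun U => f U ^+ n).
Proof.
move=> [p hp fE]; exists (p ^+ n); first exact: dhomogMn.
by move=> U; rewrite rmorphXn /= fE.
Qed.

Lemma form_gminor (f1 f2 : V -> F^o) : linear f1 -> linear f2 -> is_form 1 (gminor f1 f2).
Proof.
move=> l1 l2; pose b := (vbasis {:V}).
pose p : {mpoly F[d * d]} :=
  \sum_(i < d) \sum_(j < d) (f1 b`_i * f2 b`_j : F) *: 'X_(mxvec_index i j).
exists p; first by apply: rpred_sum => i _; apply: rpred_sum => j _; apply: dhomogZ; rewrite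
    dhomogX /= mdeg1.
move=> U; rewrite /p raddf_sum /=.
under eq_bigr => i _ do rewrite raddf_sum /=.
under eq_bigr => i _ do under eq_bigr => j _ do rewrite mevalZ mevalXU mxvecE mxE.
have S (g h : V -> F^o) (x y : V) : linear g -> linear h ->
    g x * h y = \sum_(i < d) \sum_(j < d) g b`_i * h b`_j * (lin_coord x i * lin_coord y j) :> F.
  move=> lg lh; rewrite (linear_lin_coord_sum x lg) (linear_lin_coord_sum y lh) mulr_suml.
  apply: eq_bigr => i _; rewrite mulr_sumr; apply: eq_bigr => j _.
  by rewrite /GRing.scale /=; ring.
rewrite /gminor /minor !S // -sumrB; apply: eq_bigr => i _; rewrite -sumrB.
by apply: eq_bigr => j _; rewrite -mulrBr; congr (_ * (_ - _)); rewrite mulrC.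
Qed.

Lemma plane_dense n (cu cv : 'rV[F]_n -> V) (g : 'rV[F]_n -> F) x0 (A : T -> Prop) :
  vmap (@pfun F n) cu -> vmap (@pfun F n) cv -> pfun g -> g x0 != 0 ->
  (forall x, g x != 0 -> exists2 U : T, A U & val U = (<[cu x]> + <[cv x]>)%VS) ->
  forall x (U : T), val U = (<[cu x]> + <[cv x]>)%VS -> zclosure A U.
Proof.
move=> hu hv hg g0 hA x U UE Z [S S1 S2] AZ; apply/S2 => e f Sf.
have [p pE] := form_wedge (S1 _ _ Sf).
have [del _ [dE _]] := plane_scale UE; rewrite (pE _ _ _ _ dE).
suff -> : p.@[fun m => mxvec (wedge (cu x) (cv x)) 0 m] = 0 by rewrite mulr0.
pose h y := p.@[fun m => mxvec (wedge (cu y) (cv y)) 0 m].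
have ph : pfun h.
  apply: (fa_meval (@pfun_alg F n)); case/mxvec_indexP => i j.
  apply: (fa_ext (@pfun_alg F n) (f := fun y => lin_coord (cu y) i * lin_coord (cv y) j
    - lin_coord (cu y) j * lin_coord (cv y) i)); last by move=> y; rewrite mxvecE mxE.
  by apply: (fa_sub (@pfun_alg F n)); apply: (fa_mul (@pfun_alg F n)).
apply: (pfun_dense ph hg g0) => y /hA[U' AU' U'E].
have [del' d0' [dE' _]] := plane_scale U'E.
have /S2/(_ _ _ Sf) := AZ _ AU'; rewrite (pE _ _ _ _ dE') => /eqP.
by rewrite mulf_eq0 expf_eq0 (negPf d0') andbF => /eqP.
Qed.

Section Chart.
Variables alpha beta : V -> F^o.
Hypotheses (la : linear alpha) (lb : linear beta).

Definition chart_form : T -> F := gminor alpha beta.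

Lemma form_chart_form : is_form 1 chart_form. Proof. exact: form_gminor. Qed.

Definition drat (f : T -> F) := exists n G, is_form n G /\ forall U, chart_form U != 0 -> f U = G
    U / chart_form U ^+ n.

Lemma drat_alg : funalg drat.
Proof.
split=> [f g [n [G [h e]]] fg|c|f g [n [G [h e]]] [m [H [h' e']]]|f g [n [G [h e]]] [m [H [h'
    e']]]].
- by exists n, G; split=> // U; rewrite -fg; apply: e.
- exists 0%N, (fun=> c); split=> [|U _]; first exact: form_cst.
  by rewrite expr0 divr1.
- exists (n + m)%N, (fun U => G U * chart_form U ^+ m + H U * chart_form U ^+ n); split=> [|U D0].
    apply: form_add; last rewrite addnC.
      by apply: form_mul => //; rewrite -[X in is_form X]mul1n; apply/form_exp/form_chart_form.
    by apply: form_mul => //; rewrite -[X in is_form X]mul1n; apply/form_exp/form_chart_form.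
  by rewrite e // e' // addf_div ?expf_neq0 // exprD.
exists (n + m)%N, (fun U => G U * H U); split=> [|U D0]; first exact: form_mul.
by rewrite e // e' // mulf_div exprD.
Qed.

Lemma drat_zclosed f : drat f -> zclosed (fun U => chart_form U != 0 -> f U = 0).
Proof.
move=> [n [G [h e]]]; apply: (zclosed_ext (zclosed_form (form_mul form_chart_form h))) => U.
have [->|D0] := eqVneq (chart_form U) 0; first by rewrite mul0r; split.
split=> [/eqP|/(_ isT)/eqP].
  by rewrite mulf_eq0 (negPf D0) => /eqP G0 _; rewrite e // G0 mul0r.
by rewrite e // mulf_eq0 invr_eq0 expf_eq0 (negPf D0) andbF orbF => /eqP->; rewrite mulr0.
Qed.

Definition chart_gen1 (U : T) : V := (chart_form U)^-1 *: (beta (gbase U 1) *: gbase U 0 - beta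
    (gbase U 0) *: gbase U 1).
Definition chart_gen2 (U : T) : V := (chart_form U)^-1 *: (alpha (gbase U 0) *: gbase U 1 - alpha
    (gbase U 1) *: gbase U 0).

Lemma drat_gminor (f1 f2 : V -> F^o) : linear f1 -> linear f2 -> drat (fun U => gminor f1 f2 U /
    chart_form U).
Proof.
move=> l1 l2; exists 1%N, (gminor f1 f2); split=> [|U _]; first exact: form_gminor.
by rewrite expr1.
Qed.

Lemma linear_coord (f : V -> F^o) (a b : F) (u v : V) : linear f ->
  f (a *: u - b *: v) = a * f u - b * f v :> F.
Proof.
move=> lf; have f0 : f 0 = 0 :> F^o.
  by apply: (addrI (f 0)); rewrite addr0 -{1}[f 0]scale1r -lf scale1r addr0.
have fZ c w : f (c *: w) = c *: f w by rewrite -[c *: w]addr0 lf f0 addr0.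
by rewrite lf -scaleNr fZ scaleNr.
Qed.

Lemma vmap_chart_gen1 : vmap drat chart_gen1.
Proof.
move=> i; apply: (fa_ext drat_alg (drat_gminor (f1 := fun x => lin_coord x i) _ lb)).
  by move=> a x y; rewrite /lin_coord linearP.
move=> U; rewrite /chart_gen1 /gminor /minor /lin_coord linearZ linearB !linearZ /=.
by rewrite /GRing.scale /=; ring.
Qed.

Lemma vmap_chart_gen2 : vmap drat chart_gen2.
Proof.
move=> i; apply: (fa_ext drat_alg (drat_gminor (f2 := fun x => lin_coord x i) la _)).
  by move=> a x y; rewrite /lin_coord linearP.
move=> U; rewrite /chart_gen2 /gminor /minor /lin_coord linearZ linearB !linearZ /=.
by rewrite /GRing.scale /=; ring.
Qed.

Lemma linear_coordZ (f : V -> F^o) (a : F) (u : V) : linear f -> f (a *: u) = a * f u :> F.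
Proof. by move=> lf; have := linear_coord a 0 u 0 lf; rewrite scale0r mul0r !subr0. Qed.

Lemma chart_gen_dual U : chart_form U != 0 ->
  [/\ alpha (chart_gen1 U) = 1, beta (chart_gen1 U) = 0, alpha (chart_gen2 U) = 0 & beta
      (chart_gen2 U) = 1].
Proof.
rewrite /chart_gen1 /chart_gen2 => D0; have DE : chart_form U = alpha (gbase U 0) * beta (gbase U 1)
  - alpha (gbase U 1) * beta (gbase U 0) by [].
split; rewrite (linear_coordZ _ _ la) || rewrite (linear_coordZ _ _ lb);
  rewrite (linear_coord _ _ _ _ la) || rewrite (linear_coord _ _ _ _ lb).
- by rewrite -(mulVf D0) {3}DE; congr (_ * _); ring.
- by rewrite (mulrC (beta _)) subrr mulr0.
- by rewrite (mulrC (alpha _)) subrr mulr0.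
- by rewrite -(mulVf D0) {3}DE; congr (_ * _).
Qed.

Lemma dual_dim u v : alpha u = 1 -> beta u = 0 -> alpha v = 0 -> beta v = 1 ->
  \dim (<[u]> + <[v]>)%VS = 2%N.
Proof.
move=> au bu av bv; rewrite dim_line_add; last first.
  apply/negP => /vlineP[c vE]; move: bv; rewrite vE (linear_coordZ _ _ lb) bu mulr0.
  by move/esym/eqP; rewrite oner_eq0.
rewrite dim_vline; case: eqVneq => // u0; move: au; rewrite u0.
have := linear_coordZ 0 0 la; rewrite scale0r mul0r => -> /esym/eqP.
by rewrite oner_eq0.
Qed.

Lemma chart_gen_span U : chart_form U != 0 -> val U = (<[chart_gen1 U]> + <[chart_gen2 U]>)%VS.
Proof.
move=> D0; have [a1 b1 a2 b2] := chart_gen_dual D0.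
apply/eqP; rewrite eq_sym eqEdim gr2_dim dual_dim // andbT.
have [m0 m1] : gbase U 0 \in val U /\ gbase U 1 \in val U.
  rewrite gbase_span; split; [rewrite -[X in X \in _]addr0 | rewrite -[X in X \in _]add0r];
  by rewrite memv_add ?mem0v ?memv_line.
by rewrite subv_add -!memvE /chart_gen1 /chart_gen2 !memvZ // memvB // memvZ.
Qed.

Lemma chart_gen_unique U u v : alpha u = 1 -> beta u = 0 -> alpha v = 0 -> beta v = 1 ->
  val U = (<[u]> + <[v]>)%VS -> [/\ chart_form U != 0, chart_gen1 U = u & chart_gen2 U = v].
Proof.
move=> au bu av bv UE; have [del del0 [_ h]] := plane_scale UE.
have D0 : chart_form U != 0.
  by rewrite /chart_form h // /minor au bu av bv mulr1 mul0r subr0 mulr1.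
have [a1 b1 a2 b2] := chart_gen_dual D0.
have comb (a b : F) : alpha (a *: u - b *: v) = a /\ beta (a *: u - b *: v) = - b.
  by rewrite !linear_coord // au bu av bv !mulr0 !mulr1 subr0 sub0r.
have main w : w \in val U -> w = alpha w *: u - (- beta w) *: v.
  rewrite UE => /mem_plane[a [b ->]]; rewrite -[b *: v]opprK -scaleNr.
  by have [-> ->] := comb a (- b); rewrite opprK.
have UE' := chart_gen_span D0.
split=> //.
  rewrite (main (chart_gen1 U)) ?a1 ?b1 ?scale1r ?oppr0 ?scale0r ?subr0 // UE'.
  by rewrite -[X in X \in _]addr0 memv_add ?mem0v ?memv_line.
rewrite (main (chart_gen2 U)) ?a2 ?b2 ?scaleN1r ?opprK ?scale0r ?add0r // UE'.
by rewrite -[X in X \in _]add0r memv_add ?mem0v ?memv_line.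
Qed.

End Chart.
End GrassmannianForms.

Section ChartMaps.
Variable F : numClosedFieldType.
Variable k : nat.
Local Notation A := (cd_alg F k).
Local Notation J := (herm3 F k).
Local Notation one := (cd_one F k).
Implicit Types X Y : J.

Lemma kb_linear : linear (@kb F k : J -> F^o).
Proof. by move=> c X Y; rewrite /kb !hcompE. Qed.

Lemma kr_linear : linear (@kr F k : J -> F^o).
Proof. by move=> c X Y; rewrite /kr !hcompE cd_dotDl cd_dotZl /GRing.scale /=; ring. Qed.

Lemma kz_linear : linear (@kz F k).
Proof.
move=> c X Y; rewrite /kz !hcompE cd_conjD cd_conjZ; apply/rowP => i; rewrite !mxE; ring.
Qed.

Lemma kx_linear : linear (@kx F k).
Proof. by move=> c X Y; rewrite /kx !hcompE; apply/rowP => i; rewrite !mxE; ring. Qed.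

Lemma ky_linear : linear (@ky F k).
Proof.
by move=> c X Y; rewrite /ky !hcompE !cd_conjD !cd_conjZ; apply/rowP => i; rewrite !mxE; ring.
Qed.

Lemma cd_mul_bil : (forall z : A, linear (@cd_mul F k ^~ z)) * (forall z : A, linear (cd_mul z)).
Proof. by have [] := cd_mul_bilinear F k. Qed.

Lemma cd_dot_bil : (forall z : A, linear (@cd_dot F k ^~ z : A -> F^o)) *
  (forall z : A, linear (cd_dot z : A -> F^o)).
Proof. by split=> z c x y; rewrite ?cd_dotDl ?cd_dotDr ?cd_dotZl ?cd_dotZr. Qed.

Lemma jp_bil : (forall z : J, linear (@jp F k ^~ z)) * (forall z : J, linear (jp z)).
Proof. by split=> z c x y; rewrite ?jpDl ?jpDr ?jpZl ?jpZr. Qed.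

Section Regular.
Variables (T : Type) (R : (T -> F) -> Prop).
Hypothesis RP : funalg R.
Implicit Types (w x y z : T -> A) (b r s lam c : T -> F).

Lemma vmap_mul x y : vmap R x -> vmap R y -> vmap R (fun t => cd_mul (x t) (y t)).
Proof. exact: (vmap_bilinear RP cd_mul_bil). Qed.

Lemma vmap_conj x : vmap R x -> vmap R (fun t => cd_conj (x t)).
Proof. by apply: (vmap_linear RP); apply: cd_conj_is_linear. Qed.

Lemma fa_dot x y : vmap R x -> vmap R y -> R (fun t => cd_dot (x t) (y t)).
Proof. exact: (fa_bilinear RP cd_dot_bil). Qed.

Lemma fa_q x : vmap R x -> R (fun t => cd_q (x t)).
Proof. by move=> h; apply: fa_dot. Qed.

Lemma fa_mul2n f : R f -> R (fun t => f t *+ 2).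
Proof.
by move=> h; apply: (fa_ext RP (fa_add RP h h)) => t; rewrite mulr2n.
Qed.

Lemma fa_t x : vmap R x -> R (fun t => cd_t (x t)).
Proof. by move=> h; apply: fa_mul2n; apply: fa_dot h (vmap_cst RP _). Qed.

Lemma vmap_kf b r s z x y : R b -> R r -> R s -> vmap R z -> vmap R x -> vmap R y ->
  vmap R (fun t => kf (b t) (r t) (s t) (z t) (x t) (y t)).
Proof.
move=> hb hr hs' hz hx hy.
have lz : linear (fun a : A => kf 0 0 0 a 0 0).
  by move=> c u v; rewrite -kf_linear !mulr0 !scaler0 !addr0.
have lx : linear (fun a : A => kf 0 0 0 0 a 0).
  by move=> c u v; rewrite -kf_linear !mulr0 !scaler0 !addr0.
have ly : linear (fun a : A => kf 0 0 0 0 0 a).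
  by move=> c u v; rewrite -kf_linear !mulr0 !scaler0 !addr0.
have := vmapD RP (vmapD RP (vmapD RP (vmapZ RP hb (vmap_cst RP (kf 1 0 0 0 0 0)))
  (vmapZ RP hr (vmap_cst RP (kf 0 1 0 0 0 0)))) (vmapZ RP hs' (vmap_cst RP (kf 0 0 1 0 0 0))))
  (vmapD RP (vmap_linear RP lz hz) (vmapD RP (vmap_linear RP lx hx) (vmap_linear RP ly hy))).
by move/(vmap_ext RP); apply=> t; rewrite !kfZ !kfD !mulr0 !mulr1 !scaler0 !addr0 !add0r.
Qed.

Section GraphMaps.
Variables (w x1 x2 : T -> A) (lam c : T -> F).
Hypotheses (hw : vmap R w) (h1 : vmap R x1) (h2 : vmap R x2) (hl : R lam) (hc : R c).

Lemma fa_gkappa : R (fun t => gkappa (x1 t) (x2 t) (lam t)).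
Proof.
apply: (fa_add RP); last by apply/fa_mul2n/fa_dot.
by apply: (fa_mul RP) hl; apply: (fa_cst RP).
Qed.

Lemma vmap_gz1 : vmap R (fun t => gz1 (w t) (x1 t)).
Proof.
apply: (vmapB RP) => //; apply: (vmapZ RP) (vmap_cst RP _).
by apply: (fa_mul RP) (fa_cst RP _); apply: (fa_add RP); [apply: fa_t | apply: fa_q].
Qed.

Lemma vmap_gu1 : vmap R (fun t => gu1 (w t) (x1 t) (x2 t) (lam t) (c t)).
Proof.
apply: vmap_kf => //.
- by apply: (fa_opp RP); apply/fa_t/vmap_gz1.
- exact: (fa_cst RP).
- by apply: (fa_sub RP); [apply: fa_q | apply: (fa_mul RP) hc; apply: fa_gkappa].
- exact: vmap_gz1.
by apply: (vmapD RP); [apply: (vmapZ RP) => //; apply: vmap_conj |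
  apply: vmap_mul => //; apply: vmap_conj].
Qed.

Lemma vmap_gu2 : vmap R (fun t => gu2 (w t) (x1 t) (x2 t) (lam t) (c t)).
Proof.
apply: vmap_kf => //.
- apply: (fa_add RP); last by apply/fa_mul2n/fa_dot.
  by apply: (fa_mul RP) hl; apply: (fa_cst RP).
- exact: (fa_cst RP).
- apply: (fa_add RP); last by apply: (fa_mul RP); [apply: fa_gkappa | apply: fa_q].
  apply: (fa_add RP); first by apply: (fa_mul RP) hc; apply: fa_q.
  by apply/fa_mul2n/fa_dot => //; apply: vmap_mul.
- apply: (vmapN RP); apply: (vmapD RP); first exact: (vmapZ RP) hl (vmap_cst RP _).
  by apply: vmap_mul => //; apply: vmap_conj.
apply: (vmapN RP); apply: (vmapD RP); first by apply/vmap_conj/vmap_mul.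
by apply: (vmapZ RP); [apply: fa_gkappa | apply: vmap_conj].
Qed.

Lemma fa_pmake (i0 : 'I_(cd_dim k)) m : R (fun t => pmake i0 (w t) (x1 t) (x2 t) (lam t) (c t) 0 m).
Proof.
case/mxvec_indexP: m => i j.
pose f i t := ([:: w t; x1 t + lam t *: delta_mx 0 i0; x2 t + (c t - 1) *: delta_mx 0 i0]`_i : A)
    0 j.
apply: (fa_ext RP (f := f i)); last by move=> t; rewrite mxvecE mxE.
move: i; apply: ord3P; rewrite /f inordK //=.
- exact: (vmap_rowE RP).
- by apply: (vmap_rowE RP (c := fun t => _ + _)); apply: (vmapD RP) => //; apply: (vmapZ RP)
    (vmap_cst RP _).
apply: (vmap_rowE RP (c := fun t => _ + _)); apply: (vmapD RP) => //; apply: (vmapZ RP) (vmap_cst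
    RP _).
by apply: (fa_sub RP) hc (fa_cst RP _).
Qed.

End GraphMaps.

Lemma fa_pcoord (i0 : 'I_(cd_dim k)) (X Y : T -> J) m : vmap R X -> vmap R Y ->
  R (fun t => pcoord i0 (X t) (Y t) 0 m).
Proof.
move=> hX hY.
have zX := vmap_linear RP kz_linear hX; have xX := vmap_linear RP kx_linear hX.
have yX := vmap_linear RP ky_linear hX; have xY := vmap_linear RP kx_linear hY.
have hw : vmap R (fun t => kz (X t) + (cd_t (kz (X t)) + cd_q (kx (X t))) *: one).
  apply: (vmapD RP) => //; apply: (vmapZ RP) (vmap_cst RP _).
  by apply: (fa_add RP); [apply: fa_t | apply: fa_q].
apply: (fa_pmake (w := fun t => _)) => //.
  apply: (fa_sub RP); last exact: fa_dot.
  by apply: (fa_mul RP) (fa_cst RP _) _; apply: (fa_form RP kb_linear).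
apply: (vmap_rowE RP (c := fun t => _ - _)); apply: (vmapB RP); first exact: vmap_conj.
by apply: vmap_mul => //; apply: vmap_conj.
Qed.

Lemma fa_herm_s (X : T -> J) : vmap R X -> R (fun t => herm_s (X t)).
Proof.
move=> hX; have hdR j : R (fun t => hdiag j (X t)).
  by apply: (fa_form RP (L := hdiag j : J -> F^o) _ hX) => a u v; rewrite hdiagD hdiagZ.
have hoR j : vmap R (fun t => hoff j (X t)).
  by apply: (vmap_linear RP (L := hoff j : J -> A) _ hX) => a u v; rewrite hoffD hoffZ.
by rewrite /herm_s; do !apply: (fa_sub RP); do ?apply: (fa_add RP); try apply: fa_q => //;
  apply: (fa_mul RP).
Qed.

Lemma fa_herm_det (X : T -> J) : vmap R X -> R (fun t => herm_det (X t)).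
Proof.
move=> hX; have hdR j : R (fun t => hdiag j (X t)).
  by apply: (fa_form RP (L := hdiag j : J -> F^o) _ hX) => a u v; rewrite hdiagD hdiagZ.
have hoR j : vmap R (fun t => hoff j (X t)).
  by apply: (vmap_linear RP (L := hoff j : J -> A) _ hX) => a u v; rewrite hoffD hoffZ.
apply: (fa_add RP); last by apply/fa_mul2n/fa_dot => //; apply: vmap_mul.
do ![apply: (fa_sub RP)]; apply: (fa_mul RP) => //; first exact: (fa_mul RP).
all: exact: fa_q.
Qed.

Lemma fa_herm_disc (X : T -> J) : vmap R X -> R (fun t => herm_disc (X t)).
Proof.
move=> hX; apply: (fa_add RP); apply: (fa_mul RP) (fa_cst RP _) _; apply: (fa_exp RP).
  exact: fa_herm_s.
exact: fa_herm_det.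
Qed.

End Regular.

End ChartMaps.

(** * The big cell of the variety of reductions *)

Section BigCell.
Variable F : numClosedFieldType.
Variable k : nat.
Hypothesis hk : (k <= 3)%N.
Variable i0 : 'I_(cd_dim k).
Hypothesis one_i0 : cd_one F k 0 i0 = 1.
Local Notation A := (cd_alg F k).
Local Notation J := (herm3 F k).
Local Notation one := (cd_one F k).
Local Notation T := (grassmannian2 (herm_traceless F k)).
Local Notation V := 'rV[F]_(3 * cd_dim k).
Implicit Types (X Y : J) (U : T) (v : V).

Definition cell_alpha X : F^o := kr X.
Definition cell_beta X : F^o := kx X 0 i0.

Lemma cell_alpha_linear : linear cell_alpha. Proof. exact: kr_linear. Qed.

Lemma cell_beta_linear : linear cell_beta.
Proof. by move=> c X Y; rewrite /cell_beta kx_linear !mxE. Qed.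

Local Notation D := (@chart_form F J (herm_traceless F k) cell_alpha cell_beta).
Local Notation n1 := (@chart_gen1 F J (herm_traceless F k) cell_alpha cell_beta).
Local Notation n2 := (@chart_gen2 F J (herm_traceless F k) cell_alpha cell_beta).

Lemma cell_gen_dual v : [/\ cell_alpha (cell_gen1 i0 v) = 1, cell_beta (cell_gen1 i0 v) = 0,
  cell_alpha (cell_gen2 i0 v) = 0 & cell_beta (cell_gen2 i0 v) = 1].
Proof.
rewrite /cell_alpha /cell_beta /cell_gen1 /cell_gen2 /gu1 /gu2.
by split; rewrite ?kr_kf ?kx_kf ?px1_i0 ?px2_i0.
Qed.

Definition gen_plane v : {vspace J} := (<[cell_gen1 i0 v]> + <[cell_gen2 i0 v]>)%VS.

Lemma gen_planeP v : (gen_plane v <= herm_traceless F k)%VS && (\dim (gen_plane v) == 2%N).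
Proof.
have [a1 b1 a2 b2] := cell_gen_dual v.
rewrite (dual_dim cell_alpha_linear cell_beta_linear a1 b1 a2 b2) eqxx andbT.
by rewrite subv_add -!memvE !mem_traceless gu1_tr gu2_tr eqxx.
Qed.

Definition cell_plane v : T := Sub (gen_plane v) (gen_planeP v).
Definition cell_coord U : V := pcoord i0 (n1 U) (n2 U).

Lemma chart_gen_cell v : [/\ D (cell_plane v) != 0, n1 (cell_plane v) = cell_gen1 i0 v & n2
    (cell_plane v) = cell_gen2 i0 v].
Proof.
have [a1 b1 a2 b2] := cell_gen_dual v.
exact: (chart_gen_unique cell_alpha_linear cell_beta_linear a1 b1 a2 b2).
Qed.

Lemma cell_planeK v : cell_coord (cell_plane v) = v.
Proof. by have [_ e1 e2] := chart_gen_cell v; rewrite /cell_coord e1 e2 pcoordK. Qed.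

Definition sq_proj X : J := herm_proj (jp X X).

Lemma sq_cell_gen2 v : sq_proj (cell_gen2 i0 v) = cd_q (px2 i0 v) *: cell_gen1 i0 v + plam i0 v
    *: cell_gen2 i0 v.
Proof.
have e : jp (cell_gen2 i0 v) (cell_gen2 i0 v) = cd_q (px2 i0 v) *: cell_gen1 i0 v
    + (plam i0 v *: cell_gen2 i0 v + gmu (pw v) (px1 i0 v) (px2 i0 v) (plam i0 v) *: herm_id F k).
  exact: gu2_sq.
have t1 : herm_tr (cell_gen1 i0 v) = 0 by exact: gu1_tr.
have t2 : herm_tr (cell_gen2 i0 v) = 0 by exact: gu2_tr.
have p1 : herm_proj (cd_q (px2 i0 v) *: cell_gen1 i0 v) = cd_q (px2 i0 v) *: cell_gen1 i0 v.
  by apply: herm_proj_traceless; rewrite herm_trZ t1 mulr0.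
have p2 : herm_proj (plam i0 v *: cell_gen2 i0 v) = plam i0 v *: cell_gen2 i0 v.
  by apply: herm_proj_traceless; rewrite herm_trZ t2 mulr0.
have p3 c : herm_proj (c *: herm_id F k) = 0.
  exact: etrans (herm_projZ _ _) (etrans (congr1 _ (herm_proj_id F k)) (scaler0 _ _)).
rewrite /sq_proj e; apply: etrans (herm_projD _ _) _; rewrite p1; congr (_ + _).
by apply: etrans (herm_projD _ _) _; rewrite p2 p3 addr0.
Qed.

Lemma mem_lineXl X : X \in lineX X.
Proof. by rewrite -[X in X \in _]addr0 memv_add ?mem0v ?memv_line. Qed.

Lemma mem_lineXr X : sq_proj X \in lineX X.
Proof. by rewrite -[X in X \in _]add0r memv_add ?mem0v ?memv_line. Qed.

Lemma gen_plane_lineX X v : (gen_plane v <= lineX X)%VS -> gen_plane v = lineX X.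
Proof.
move=> sub; apply/eqP; rewrite eqEdim sub /=.
by have /andP[_ /eqP->] := gen_planeP v; apply: dim_lineX.
Qed.

Lemma gen_plane_gen v : cd_q (px2 i0 v) != 0 -> gen_plane v = lineX (cell_gen2 i0 v).
Proof.
move=> Q0; apply: gen_plane_lineX; rewrite subv_add -!memvE; apply/andP; split; last exact:
    mem_lineXl.
have -> : cell_gen1 i0 v = (cd_q (px2 i0 v))^-1 *: (sq_proj (cell_gen2 i0 v) - plam i0 v *:
    cell_gen2 i0 v).
  by rewrite sq_cell_gen2 addrK scalerA mulVf // scale1r.
by apply: memvZ; apply: memvB; [apply: mem_lineXr | apply: memvZ; apply: mem_lineXl].
Qed.

Definition gen_norm X Y : F := cd_q (cell_alpha X *: kx Y - cell_alpha Y *: kx X).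

Lemma lineX_gen_plane X : herm_tr X = 0 -> minor cell_alpha cell_beta X (sq_proj X) != 0 ->
    gen_norm X (sq_proj X) != 0 ->
  exists v, lineX X = gen_plane v.
Proof.
move=> trX m0 q0; set Y := sq_proj X in m0 q0 *; set m := minor _ _ _ _ in m0.
pose Z : J := (m^-1 * cell_alpha X) *: Y - (m^-1 * cell_alpha Y) *: X.
have kxZ : kx Z = m^-1 *: (cell_alpha X *: kx Y - cell_alpha Y *: kx X).
  have kxE (a b : F) X1 X2 : kx (a *: X1 - b *: X2) = a *: kx X1 - b *: kx X2.
    by rewrite /kx !hcompE; apply/rowP => i; rewrite !mxE; ring.
  by rewrite /Z kxE scalerBr !scalerA.
have ZL : Z \in lineX X.
  apply: memvB; apply: memvZ; [exact: mem_lineXr | exact: mem_lineXl].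
have trZ : herm_tr Z = 0.
  by apply/eqP; rewrite -mem_traceless (subvP (lineX_traceless trX)).
have aZ : kr Z = 0.
  have := linear_coord (m^-1 * cell_alpha X) (m^-1 * cell_alpha Y) Y X cell_alpha_linear.
  by rewrite -/Z /cell_alpha => ->; ring.
have bZ : (kx Z : A) 0 i0 = 1.
  have := linear_coord (m^-1 * cell_alpha X) (m^-1 * cell_alpha Y) Y X cell_beta_linear.
  rewrite -/Z => e; rewrite -[LHS]/(cell_beta Z : F) e -(mulVf m0) /m /minor.
  set mm := (_ - _)^-1; ring.
have qZ : cd_q (kx Z) != 0.
  rewrite kxZ /cd_q cd_dotZl cd_dotZr -/(cd_q _) !mulf_neq0 ?invr_eq0 //.
have [w [x1 [lam [c [x10 ZE]]]]] := gu2_solve hk trZ aZ bZ qZ.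
exists (pmake i0 w x1 (kx Z) lam c).
have [pw_ p1 p2 pl pc_] := pmakeK w lam c x10 bZ.
set v := pmake _ _ _ _ _ _ in pw_ p1 p2 pl pc_ *.
have pu2E : cell_gen2 i0 v = Z by rewrite /cell_gen2 pw_ p1 p2 pl pc_ -ZE.
have Qv : cd_q (px2 i0 v) != 0 by rewrite p2.
apply/esym; apply: gen_plane_lineX; rewrite (gen_plane_gen Qv) pu2E.
rewrite subv_add -!memvE ZL /=; exact: lineX_closed.
Qed.

Definition cyc3 : J := kf 0 0 1 0 one 0.

Lemma cyc3_tr : herm_tr cyc3 = 0.
Proof. by rewrite kf_tr /cd_t cd_dot0l add0r mul0rn. Qed.

Lemma cyc3_sq : sq_proj cyc3 = kf 0 1 0 0 0 one.
Proof.
have e : jp cyc3 cyc3 = kf 0 1 0 0 0 one.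
  rewrite kf_sq // !cd_mul0l !cd_mul0r /cd_t !cd_dot0l cd_q1 cd_conj0 cd_conj1 /cd_q cd_dot0l.
  by rewrite !(mul0rn, mul0r, scale0r, addr0, add0r, expr0n, scaler0, scale1r).
by rewrite /sq_proj e herm_proj_traceless // kf_tr /cd_t cd_dot0l add0r mul0rn.
Qed.

Lemma cyc3_disc : herm_disc cyc3 != 0.
Proof.
have q1 : cd_dot one one = 1 := cd_q1 F k.
have i2 : ('i * 'i : F) = -1 by rewrite -expr2 sqrCi.
have hsE : herm_s cyc3 = 0.
  rewrite /herm_s /cyc3 !mkHE; set ii := 'i in i2 *.
  rewrite cd_conj0 !scaler0 subrr scaler0 !addr0 cd_dot0l subr0 /cd_q.
  by rewrite !(cd_dotZl, cd_dotZr) q1; field: i2.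
have hdE : herm_det cyc3 = 1.
  rewrite /herm_det /cyc3 !mkHE; set ii := 'i in i2 *.
  rewrite cd_conj0 !scaler0 subrr scaler0 !addr0 cd_dot0l subr0 /cd_q.
  by rewrite !(cd_mulZl, cd_mulZr, cd_mulr1) !(cd_dotZl, cd_dotZr) q1; field: i2.
by rewrite /herm_disc hsE hdE expr0n mulr0 add0r expr1n mulr1 pnatr_eq0.
Qed.

Lemma cyc3_comp : [/\ cell_alpha cyc3 = 0, cell_beta cyc3 = 1, cell_alpha (sq_proj cyc3) = 1,
    cell_beta (sq_proj cyc3) = 0 &
   kx cyc3 = one].
Proof.
by rewrite cyc3_sq /cell_alpha /cell_beta /cyc3 !kr_kf !kx_kf mxE.
Qed.

Definition traceless_of (t : 'rV[F]_(\dim {:J})) : J := herm_proj (\sum_i t 0 i *: (vbasis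
    {:J})`_i).

Lemma traceless_of_surj X : herm_tr X = 0 -> exists t, traceless_of t = X.
Proof.
move=> trX; exists (\row_i lin_coord X i); rewrite /traceless_of.
under eq_bigr => i _ do rewrite mxE.
by rewrite -lin_coord_sum herm_proj_traceless.
Qed.

Lemma herm_proj_lin : linear (@herm_proj F k).
Proof. exact: herm_proj_is_linear. Qed.

Lemma vmap_traceless_of : vmap (@pfun F _) traceless_of.
Proof.
have P := @pfun_alg F (\dim {:J}).
apply: (vmap_linear P herm_proj_lin (c := fun t => \sum_i t 0 i *: (vbasis {:J})`_i)) => j.
have Q : pfun (fun x : 'rV[F]_(\dim {:J}) => x 0 j) by exact: pfun_coord.
refine (fa_ext P Q _) => t.
rewrite /lin_coord linear_sum (bigD1 j) //= linearZ /= coord_free ?(basis_free (vbasisP _)) //.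
rewrite eqxx /GRing.scale /= mulr1 big1 ?addr0 // => i ne.
rewrite linearZ /= coord_free ?(basis_free (vbasisP _)) //.
by rewrite (negPf ne) /GRing.scale /= mulr0.
Qed.

Lemma vmap_sq_proj : vmap (@pfun F _) (fun t => sq_proj (traceless_of t)).
Proof.
have P := @pfun_alg F (\dim {:J}).
apply: (vmap_linear P herm_proj_lin); apply: (vmap_bilinear P (@jp_bil F k)); exact:
    vmap_traceless_of.
Qed.

Lemma reduction_line_dense (g : J -> J -> F) (B : T -> Prop) :
  pfun (fun t => g (traceless_of t) (sq_proj (traceless_of t))) -> g cyc3 (sq_proj cyc3) != 0 ->
  (forall X, herm_tr X = 0 -> g X (sq_proj X) != 0 -> exists2 U, B U & val U = lineX X) ->
  forall U, reduction_line U -> zclosure B U.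
Proof.
move=> hg g0 hB U /reduction_lineX[X trX UE].
have [t0 e0] := traceless_of_surj cyc3_tr; have [t e] := traceless_of_surj trX.
apply: (plane_dense vmap_traceless_of vmap_sq_proj hg (x0 := t0) _ _ (x := t)); rewrite ?e0 ?e //.
by move=> y; apply: hB; apply: herm_tr_proj.
Qed.

Lemma pfun_minor : pfun (fun t => minor cell_alpha cell_beta (traceless_of t) (sq_proj
    (traceless_of t))).
Proof.
have P := @pfun_alg F (\dim {:J}).
have fX (f : J -> F^o) : linear f -> pfun (fun t => f (traceless_of t) : F) by move=> lf; apply:
    (fa_form P lf vmap_traceless_of).
have fY (f : J -> F^o) : linear f -> pfun (fun t => f (sq_proj (traceless_of t)) : F) by move=>
    lf; apply: (fa_form P lf vmap_sq_proj).
have la := cell_alpha_linear; have lb := cell_beta_linear.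
exact: (fa_sub P (fa_mul P (fX _ la) (fY _ lb)) (fa_mul P (fY _ la) (fX _ lb))).
Qed.

Lemma pfun_gen_norm : pfun (fun t => gen_norm (traceless_of t) (sq_proj (traceless_of t))).
Proof.
have P := @pfun_alg F (\dim {:J}).
apply: (fa_q P); apply: (vmapB P); apply: (vmapZ P).
- exact: (fa_form P cell_alpha_linear vmap_traceless_of).
- exact: (vmap_linear P (@kx_linear F k) vmap_sq_proj).
- exact: (fa_form P cell_alpha_linear vmap_sq_proj).
exact: (vmap_linear P (@kx_linear F k) vmap_traceless_of).
Qed.

Lemma reductions_dense_cell U :
  reductions U -> zclosure (fun U' => reductions U' /\ D U' != 0) U.
Proof.
apply: zclosure_trans => {U}; have P := @pfun_alg F (\dim {:J}).
apply: (@reduction_line_dense (fun X Y => herm_disc X * minor cell_alpha cell_beta X Y)).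
- by apply: (fa_mul P) _ pfun_minor; apply: (fa_herm_disc P vmap_traceless_of).
- have [a b a' b' _] := cyc3_comp.
  by rewrite mulf_neq0 ?cyc3_disc // /minor a b a' b' mulr0 sub0r mulr1 oppr_eq0 oner_eq0.
move=> X trX; rewrite mulf_eq0 negb_or => /andP[d0 m0].
have [U rU UE] := lineX_reduction hk trX d0; exists U => //; split.
  exact: sub_zclosure.
have [del del0 [_ h]] := plane_scale UE.
by rewrite /chart_form h ?mulf_neq0 //; [apply: cell_alpha_linear | apply: cell_beta_linear].
Qed.

Lemma vmap_cell_gen (T' : Type) (R : (T' -> F) -> Prop) (f : T' -> V) : funalg R ->
  (forall m, R (fun t => f t 0 m)) ->
  [/\ vmap R (fun t => cell_gen1 i0 (f t)), vmap R (fun t => cell_gen2 i0 (f t)) & vmap R (fun t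
      => px2 i0 (f t))].
Proof.
move=> P hf.
have hrow i j : R (fun t => vec_mx (f t) i j).
  by refine (fa_ext P (hf (mxvec_index i j)) _) => u; rewrite mxE.
have hrowv i : vmap R (fun t => row i (vec_mx (f t)) : A).
  by apply: (vmap_row P) => j; refine (fa_ext P (hrow i j) _) => u; rewrite !mxE.
have hl : R (fun t => plam i0 (f t)) by exact: (hrow (inord 1) i0).
have hc : R (fun t => pc i0 (f t)) by exact: (hrow (inord 2) i0).
have hw : vmap R (fun t => pw (f t)) by exact: (hrowv (inord 0)).
have h1 : vmap R (fun t => px1 i0 (f t)).
  by apply: (vmapB P) => //; apply: (vmapZ P) (vmap_cst P _).
have h2 : vmap R (fun t => px2 i0 (f t)).
  apply: (vmapD P) => //; apply: (vmapZ P) (vmap_cst P _).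
  exact: (fa_sub P) (fa_cst P _) hc.
by split=> //; [apply: (vmap_gu1 P) | apply: (vmap_gu2 P)].
Qed.

Lemma reductions_cell_plane v : reductions (cell_plane v).
Proof.
have P := @pfun_alg F (3 * cd_dim k).
have [u1 u2 h2] := vmap_cell_gen P (@pfun_coord F _).
pose v0 := pmake i0 0 0 one 0 1.
have [w0 p1 p2 pl pc_] : [/\ pw v0 = 0, px1 i0 v0 = 0, px2 i0 v0 = one, plam i0 v0 = 0 & pc i0 v0
    = 1].
  by apply: pmakeK; rewrite ?mxE.
apply: (plane_dense u1 u2 (g := fun v => cd_q (px2 i0 v) * herm_disc (cell_gen2 i0 v)) (x0 := v0)
    _ _ _ (x := v)) => //.
- by apply: (fa_mul P); [apply: (fa_q P) | apply: (fa_herm_disc P)].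
- have -> : cell_gen2 i0 v0 = cyc3.
    rewrite /cell_gen2 w0 p1 p2 pl pc_ /gu2 /gz2 /gkappa /cyc3 !cd_dot0r !cd_conj0 cd_mul0l
        cd_mul0r cd_conj0.
    rewrite cd_q1 /cd_q cd_dot0r.
    by rewrite !(mul0rn, mulr0, scale0r, addr0, oppr0, scaler0, mul1r).
  by rewrite p2 cd_q1 mul1r cyc3_disc.
move=> x; rewrite mulf_eq0 negb_or => /andP[Q0 d0].
have [U rU UE] := lineX_reduction hk (gu2_tr _ _ _ _ _) d0.
by exists U => //; rewrite UE -gen_plane_gen.
Qed.

Lemma drat_cell_coord m : drat cell_alpha cell_beta (fun U => cell_coord U 0 m).
Proof.
have la := cell_alpha_linear; have lb := cell_beta_linear.
by apply: (fa_pcoord (drat_alg _ la lb) i0 m); [apply: vmap_chart_gen1 | apply: vmap_chart_gen2].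
Qed.

Lemma reductions_cell U : reductions U -> D U != 0 -> cell_plane (cell_coord U) = U.
Proof.
have la := cell_alpha_linear; have lb := cell_beta_linear; have P := drat_alg (herm_traceless F
    k) la lb.
have [u1 u2 _] := vmap_cell_gen P drat_cell_coord.
pose Z U := forall j, (D U != 0 -> lin_coord (n1 U - cell_gen1 i0 (cell_coord U)) j = 0) /\
  (D U != 0 -> lin_coord (n2 U - cell_gen2 i0 (cell_coord U)) j = 0).
have cZ : zclosed Z.
  apply: (zclosed_ext (zclosed_all (Z := fun i : 'I_(\dim {:J}) + 'I_(\dim {:J}) => fun U =>
    D U != 0 -> match i with
    | inl j => lin_coord (n1 U - cell_gen1 i0 (cell_coord U)) j = 0
    | inr j => lin_coord (n2 U - cell_gen2 i0 (cell_coord U)) j = 0 end) _)) => [[j|j]|U'].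
  - by apply: drat_zclosed => //; apply: (vmapB P) u1 j; apply: vmap_chart_gen1.
  - by apply: drat_zclosed => //; apply: (vmapB P) u2 j; apply: vmap_chart_gen2.
  by split=> [h j|h [j|j]]; [split; [apply: (h (inl j)) | apply: (h (inr j))] | case: (h j) |
      case: (h j)].
have Zr U' : reduction_line U' -> Z U'.
  move=> rU; apply: (@reduction_line_dense (fun X Y => minor cell_alpha cell_beta X Y * gen_norm
      X Y)
    (fun U => exists v, U = cell_plane v) _ _ _ U' rU Z cZ).
  - exact: (fa_mul (@pfun_alg F _)) pfun_minor pfun_gen_norm.
  - have [a b a' b' x] := cyc3_comp.
    rewrite /gen_norm /minor a b a' b' x mulr0 sub0r mulr1 scale0r sub0r scale1r /cd_q cd_dotNl
        cd_dotNr.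
    by rewrite opprK -/(cd_q _) cd_q1 mulr1 oppr_eq0 oner_eq0.
  - move=> X trX; rewrite mulf_eq0 negb_or => /andP[m0 q0].
    have [v vE] := lineX_gen_plane trX m0 q0.
    by exists (cell_plane v); [exists v | rewrite vE].
  move=> _ [v ->] j; have [_ e1 e2] := chart_gen_cell v.
  by rewrite e1 e2 cell_planeK !subrr /lin_coord linear0.
move=> rU D0; have ZU := rU _ cZ Zr.
have e1 : n1 U = cell_gen1 i0 (cell_coord U).
  apply/eqP; rewrite -subr_eq0 (lin_coord_sum (n1 U - _)) big1 // => j _.
  by rewrite (ZU j).1 // scale0r.
have e2 : n2 U = cell_gen2 i0 (cell_coord U).
  apply/eqP; rewrite -subr_eq0 (lin_coord_sum (n2 U - _)) big1 // => j _.
  by rewrite (ZU j).2 // scale0r.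
by apply: val_inj; rewrite (chart_gen_span la lb D0) e1 e2.
Qed.

Lemma form_cell_plane e (f : T -> F) : is_form e f ->
  exists2 h : V -> F, pfun h & forall v, f (cell_plane v) = D (cell_plane v) ^+ e * h v.
Proof.
move=> /form_wedge[p pE]; have P := @pfun_alg F (3 * cd_dim k).
have [u1 u2 _] := vmap_cell_gen P (@pfun_coord F _).
exists (fun v => p.@[fun m => mxvec (wedge (cell_gen1 i0 v) (cell_gen2 i0 v)) 0 m]).
  apply: (fa_meval P); case/mxvec_indexP => i j.
  refine (fa_ext P (fa_sub P (fa_mul P (u1 i) (u2 j)) (fa_mul P (u1 j) (u2 i))) _) => v.
  by rewrite mxvecE mxE.
move=> v; have [del _ [dE h]] := plane_scale (erefl (val (cell_plane v))).
rewrite (pE _ _ _ _ dE); congr (_ ^+ _ * _).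
have [a1 b1 a2 b2] := cell_gen_dual v; rewrite [RHS]/chart_form h; last 2 first.
- exact: cell_alpha_linear.
- exact: cell_beta_linear.
by rewrite /minor a1 b1 a2 b2 mul0r subr0 !mulr1.
Qed.

Local Notation cell := (fun U : T => reductions U /\ D U != 0).
Local Notation affine := (affine_space F (3 * cd_dim k)).

Lemma cell_cell_plane v : cell (cell_plane v).
Proof. by split; [apply: reductions_cell_plane | have [] := chart_gen_cell v]. Qed.

Lemma zopen_cell_plane (O : T -> Prop) : zopen O -> @zopen F affine (fun v => O (cell_plane v)).
Proof.
move=> [S S1 S2]; exists (fun d (h : V -> F) => pfun h /\
    exists e f, S e f /\ forall v, f (cell_plane v) = D (cell_plane v) ^+ e * h v).
  by move=> d h [].
move=> v; split=> [/S2 h d g [_ [e [f [Sf fE]]]]|h]; last first.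
  apply/S2 => e f Sf; have [g pg gE] := form_cell_plane (S1 _ _ Sf).
  by rewrite gE (h 0%N) ?mulr0 //; split=> //; exists e, f.
have := h _ _ Sf; rewrite fE => /eqP; have [D0 _ _] := chart_gen_cell v.
by rewrite mulf_eq0 expf_eq0 (negPf D0) andbF => /eqP.
Qed.

Lemma drat_pfun_cell_coord (h : V -> F) : pfun h -> drat cell_alpha cell_beta (fun U => h
    (cell_coord U)).
Proof.
move=> [p pE]; have P := drat_alg (herm_traceless F k) cell_alpha_linear cell_beta_linear.
by refine (fa_ext P (fa_meval P p drat_cell_coord) _) => U; rewrite pE.
Qed.

Lemma zopen_cell_coord (O : V -> Prop) : @zopen F affine O ->
  exists2 O' : T -> Prop, zopen O' & forall U, D U != 0 -> (O' U <-> O (cell_coord U)).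
Proof.
move=> [S S1 S2].
pose C U := forall h : {h : V -> F | exists d, S d h}, D U != 0 -> sval h (cell_coord U) = 0.
have cC : zclosed C.
  apply: zclosed_all => -[h [d Sh]] /=; apply: (drat_zclosed cell_alpha_linear cell_beta_linear).
  by apply: drat_pfun_cell_coord; apply: (S1 _ _ Sh).
exists (fun U => ~ C U).
  by apply: (zclosed_ext cC) => U; split=> [h|/contrapT].
move=> U D0; split=> [nC|OU CU].
  apply: contrapT => /S2 h; apply: nC => -[g [d Sg]] _; exact: (h d g Sg).
suff : ~ O (cell_coord U) by [].
by apply/S2 => d h Sh; apply: (CU (exist _ h (ex_intro _ d Sh))).
Qed.

Lemma cell_isomorphic : zisomorphic cell (fun _ : affine => True).
Proof.
exists cell_coord, cell_plane; split=> [||U [rU D0]|v _]; [| |exact: reductions_cell|exact: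
    cell_planeK].
  split=> // [O /zopen_cell_coord[O' zO' O'E]|O f zO rf U [[rU D0] OU]].
    by exists O' => // U [_ D0]; apply: O'E.
  have [O1 [zO1 O1U [d [g [h [hg hh gh]]]]]] := rf (cell_coord U) (conj I OU).
  have [O2 zO2 O2E] := zopen_cell_coord zO1.
  have [n [G [fG GE]]] := drat_pfun_cell_coord hg; have [m [H [fH HE]]] := drat_pfun_cell_coord hh.
  exists O2; split=> //; first exact/O2E.
  have fD e : is_form e (fun U => D U ^+ e).
    by rewrite -[X in is_form X]mul1n; apply/form_exp/form_chart_form; [apply: cell_alpha_linear
        | apply: cell_beta_linear].
  exists (n + m)%N, (fun U => G U * D U ^+ m), (fun U => H U * D U ^+ n); split.
  - exact: form_mul.
  - by rewrite addnC; apply: form_mul.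
  move=> U' [[rU' D0'] OU'] /(O2E _ D0') O1U'; have [h0 ->] := gh _ (conj I OU') O1U'.
  have HU : H U' != 0 by apply: contraNneq h0 => H0; rewrite HE // H0 mul0r.
  split; first by rewrite mulf_neq0 ?expf_neq0.
  rewrite GE // HE //.
  by rewrite invf_div mulf_div (mulrC (D U' ^+ n)).
split=> [v _|O zO|O f zO rf v [_ Ov]]; first exact: cell_cell_plane.
  by exists (fun v => O (cell_plane v)) => //; apply: zopen_cell_plane.
have [O1 [zO1 O1v [d [g [h [hg hh gh]]]]]] := rf (cell_plane v) (conj (cell_cell_plane v) Ov).
have [g' pg gE] := form_cell_plane hg; have [h' ph hE] := form_cell_plane hh.
exists (fun v => O1 (cell_plane v)); split=> //; first exact: zopen_cell_plane.
exists d, g', h'; split=> // u [_ Ou] O1u; have [D0 _ _] := chart_gen_cell u.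
have [h0 ->] := gh _ (conj (cell_cell_plane u) Ou) O1u.
split; first by apply: contraNneq h0 => e; rewrite hE e mulr0.
by rewrite gE hE -mulf_div divff ?expf_neq0 // mul1r.
Qed.

Theorem reductions_big_cell : exists O : T -> Prop,
  [/\ zopen O, forall U, reductions U -> zclosure (fun U' => reductions U' /\ O U') U &
      zisomorphic (fun U => reductions U /\ O U) (fun _ : affine => True)].
Proof.
exists (fun U => D U != 0); split; last exact: cell_isomorphic.
  apply: (zclosed_ext (zclosed_form (form_chart_form (herm_traceless F k) cell_alpha_linear
      cell_beta_linear))) => U.
  by split=> [->|/negP]; [rewrite eqxx | rewrite negbK => /eqP].
exact: reductions_dense_cell.
Qed.

End BigCell.

Lemma cd_one_coord (F : fieldType) k : exists i0, cd_one F k 0 i0 = 1.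
Proof.
elim: k => [|k [i0 e]]; first by exists 0; rewrite mxE.
by exists (lshift _ i0); rewrite cd_oneS row_mxEl.
Qed.

Theorem theorem3p22 (R : realType) (a k : nat)
    (ha : a \in [:: 1; 2; 4; 8]%N) (hk : a = (2 ^ k)%N) :
  exists O : grassmannian2 (herm_traceless R[i] k) -> Prop,
    [/\ zopen O,
        forall U, reductions U -> zclosure (fun U' => reductions U' /\ O U') U &
        zisomorphic (fun U => reductions U /\ O U)
                    (fun _ : affine_space R[i] (3 * a) => True)].
Proof.
have k3 : (k <= 3)%N.
  rewrite leqNgt; apply/negP => k4; have : (2 ^ 4 <= a)%N by rewrite hk leq_exp2l.
  by move: ha; rewrite !inE => /or4P[] /eqP->.
have -> : a = cd_dim k by rewrite cd_dimE.
have [i0 e] := cd_one_coord R[i] k.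
exact: (reductions_big_cell k3 e).
Qed.
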